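(* There exists a tame set $E\subset\mathbb{C}^{2n}\setminus\{0\}$ which is $\Gamma$-unavoidable, that is, $f(\mathbb{C}^{2n})\cap E\neq\emptyset$ for every $f\in\Gamma$.
   Context: $n\ge 1$, and $\mathbb{C}^{2n}$ carries the symplectic form $\omega'=dz_1\wedge dz_2+\cdots+dz_{2n-1}\wedge dz_{2n}$. $\Gamma$ denotes the class of holomorphic symplectic maps $f\colon\mathbb{C}^{2n}\to\mathbb{C}^{2n}$ (i.e. holomorphic maps with $f^*\omega'=\omega'$, not necessarily automorphisms) with $f(0)=0$. A set $E\subset\mathbb{C}^{2n}$ without limit points in $\mathbb{C}^{2n}$ is tame (in the sense of Rosay and Rudin) if there is a holomorphic automorphism $\Phi$ of $\mathbb{C}^{2n}$ with $\Phi(E)=\mathbb{N}\cdot e_1=\{(j,0,\dots,0): j\in\mathbb{N}\}$, where $\mathbb{N}=\{1,2,3,\dots\}$. Since every $f\in\Gamma$ satisfies $f(0)=0$, avoidability by $\Gamma$ is only considered for sets not containing the origin. *)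

(* Defs.v *)
From HB Require Import structures.
From mathcomp Require Import all_boot all_order all_algebra.
From mathcomp Require Import all_classical all_reals all_analysis.
From mathcomp Require Import complex.

Set Implicit Arguments.
Unset Strict Implicit.
Unset Printing Implicit Defensive.

Import Order.TTheory GRing.Theory Num.Theory.
Import numFieldNormedType.Exports.

Local Open Scope classical_set_scope.
Local Open Scope ring_scope.

(* The usual topology and norm on the complex numbers: the ones given by the
   modulus, with R[i] as its own field of scalars. *)
HB.instance Definition _ (R : rcfType) := NormedModule.copy R[i] R[i]^o.

(* Vectors of C^m are row vectors over the complex numbers R[i], R being an
   arbitrary model of the real numbers; coordinates are numbered from 0. *)
Notation Cn R m := ('rV[complex R]_m).

Section HolomorphicMaps.
Variables (R : realType) (m : nat).

(* As the base field of Cn R m is R[i], differentiability is complex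
   (Frechet) differentiability, and 'd f z is the complex-linear differential. *)
Definition holomorphic (f : Cn R m -> Cn R m) : Prop :=
  forall z : Cn R m, differentiable f z.

Definition holomorphic_automorphism (f : Cn R m -> Cn R m) : Prop :=
  holomorphic f /\
  exists g : Cn R m -> Cn R m, [/\ holomorphic g, cancel f g & cancel g f].

(* For m = 0 this is the zero vector. *)
Definition e1 : Cn R m := \row_(i < m) (i == 0%N :> nat)%:R.

Definition positive_multiples_e1 : set (Cn R m) :=
  [set z | exists2 j : nat, (0 < j)%N & z = j%:R *: e1].

Definition tame (E : set (Cn R m)) : Prop :=
  limit_point E = set0 /\
  exists Phi : Cn R m -> Cn R m,
    holomorphic_automorphism Phi /\ Phi @` E = positive_multiples_e1.

Definition unavoidable (G : set (Cn R m -> Cn R m)) (E : set (Cn R m)) : Prop :=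
  forall f : Cn R m -> Cn R m, G f -> range f `&` E !=set0.

Definition dz (i : 'I_m) : Cn R m -> R[i] := fun u => u ord0 i.

Definition wedge (a b : Cn R m -> R[i]) : Cn R m -> Cn R m -> R[i] :=
  fun u v => a u * b v - a v * b u.

(* Pullback at z of the 2-form with constant coefficients w. *)
Definition pullback (f : Cn R m -> Cn R m) (w : Cn R m -> Cn R m -> R[i])
    (z : Cn R m) : Cn R m -> Cn R m -> R[i] :=
  fun u v => w ('d f z u) ('d f z v).

End HolomorphicMaps.

Arguments positive_multiples_e1 : clear implicits.

Section SymplecticMaps.
Variables (R : realType) (n : nat).

Lemma ltn_fst_index (k : 'I_n) : (2 * k < 2 * n)%N.
Proof. by rewrite ltn_pmul2l. Qed.

Lemma ltn_snd_index (k : 'I_n) : ((2 * k).+1 < 2 * n)%N.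
Proof. by rewrite !mul2n ltn_Sdouble. Qed.

(* The k-th summand is dz_(2k+1) /\ dz_(2k+2) when coordinates are numbered
   from 1. *)
Definition symplectic_form : Cn R (2 * n) -> Cn R (2 * n) -> R[i] :=
  fun u v => \sum_(k < n)
    wedge (dz (Ordinal (ltn_fst_index k))) (dz (Ordinal (ltn_snd_index k))) u v.

Definition symplectic (f : Cn R (2 * n) -> Cn R (2 * n)) : Prop :=
  forall z u v : Cn R (2 * n),
    pullback f symplectic_form z u v = symplectic_form u v.

Definition Gamma : set (Cn R (2 * n) -> Cn R (2 * n)) :=
  [set f | [/\ holomorphic f, symplectic f & f 0 = 0]].

End SymplecticMaps.

Arguments Gamma : clear implicits.

(* Main.v *)
(* Let Phi multiply the first coordinate z_1 by exp z_2. For f in Gamma, which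
   preserves volume, F := Phi o f fixes 0 and satisfies |det F'| = |exp F_2|.
   The set E is the preimage under Phi of a sequence E' that contains, for every
   k, a very fine finite net of the points w with |w| <= a_(k+1) and
   |w_i| > a_k for some i <> 2, where a_k grows like exp (c 4^k).

   If F avoids E' and |F| <= a_(k+1) on a ball, then on a smaller ball all
   coordinates but F_2 are at most a_k: elsewhere |det F'| is at least
   exp (- a_(k+1)), and a quantitative inverse function theorem shows that F
   hits the net. Cauchy's inequality bounds |det F'| = exp (Re F_2) by a power of
   a_(k+1), and the Borel-Caratheodory inequality turns this into |F_2| <= a_k.
   Descending to k = 0 on a large ball contradicts det F'(0) = 1 in modulus.

   The first coordinates of E' are made distinct, and the points of E' tend to
   infinity in the coordinates other than the second one. Hence there is an
   entire function of these coordinates that takes prescribed values on E', and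
   shears map E' to the positive multiples of e_1. *)

Require Import Defs.
From mathcomp Require Import all_boot all_order all_algebra.
From mathcomp Require Import all_classical all_reals all_analysis.
From mathcomp Require Import perm complex ring lra.

Set Implicit Arguments.
Unset Strict Implicit.
Unset Printing Implicit Defensive.

Import Order.TTheory GRing.Theory Num.Theory.
Import numFieldNormedType.Exports.

Local Open Scope classical_set_scope.
Local Open Scope ring_scope.

(** * Real derivatives, antiderivatives and Goursat's theorem *)

Section RealCalculus.
Variable R : realType.

(** Two demands on E' conflict. To catch every map whose derivative is not too degenerate, it has to
    be dense at all scales; to be straightened by shears, it must leave one direction free in which
    its points need not go to infinity. The twist reconciles them: one coordinate measures the
    degeneracy of F' and is in turn controlled by it, so points whose only large coordinate is that
    one need not be netted.

    The descent may start at any level and must still end at a_0 on a large ball. Hence the step to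
    level k may shrink the radius only by about rho * 2^-k, a summable loss. The price of a thin
    collar is that Borel-Caratheodory costs a factor exp (C * 2^k); multiplied by the logarithm of
    a_(k+1), this must stay below a_k. Taking log a_k = c * 4^k achieves it.

    The fineness of the net at level k depends on a_(k+1) and the collar only, not on F, so that E'
    can be fixed before F is given. The normalization f(0) = 0 is used both for the determinant at 0
    and as the starting value in Borel-Caratheodory. All analytic estimates go back to Cauchy's
    inequality for the first derivative. *)

Definition rdiff (f : R -> R) (x d : R) := forall e, 0 < e -> exists2 r, 0 < r &
  forall h, `|h| < r -> `|f (x + h) - f x - d * h| <= e * `|h|.

Lemma rdiffP f x d : rdiff f x d <-> is_derive x 1 f d.
Proof.
split.
- move=> H.
  have cv : (fun h => h^-1 *: ((f \o shift x) (h *: 1) - f x)) @ 0^' --> d.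
    apply/cvgrPdist_le => e e0; have [r r0 Hr] := H _ e0.
    exists r => //= h /=; rewrite sub0r normrN => hr h0.
    have h0' : h != 0 by [].
    rewrite /shift /= /GRing.scale /= mulr1 (addrC h).
    have -> : d - h^-1 * (f (x + h) - f x) = - (f (x + h) - f x - d * h) / h by field.
    by rewrite normrM normrN normfV ler_pdivrMr ?normr_gt0//; exact: Hr.
  by split; [apply/cvg_ex; exists d | apply: cvg_lim].
- move=> [dr dv] e e0.
  have /cvgrPdist_le /(_ e e0) : (fun h => h^-1 *: ((f \o shift x) (h *: 1) - f x)) @ 0^' --> d.
    by rewrite -dv; exact: dr.
  move=> [r /= r0 Hr]; exists r => // h hr.
  have [->|h0] := eqVneq h 0; first by rewrite addr0 mulr0 subrr subr0 normr0 mulr0.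
  have := Hr h; rewrite /= sub0r normrN => /(_ hr h0).
  rewrite /shift /= /GRing.scale /= mulr1 (addrC h) => K.
  have -> : f (x + h) - f x - d * h = - (d - h^-1 * (f (x + h) - f x)) * h by field.
  by rewrite normrM normrN ler_wpM2r.
Qed.

Lemma rdiff_cont f x d : rdiff f x d -> {for x, continuous f}.
Proof.
move=> /rdiffP [dr _]; apply: differentiable_continuous; exact/derivable1_diffP.
Qed.

Lemma rdiff_mvt f g a b : a <= b ->
  (forall x, a <= x <= b -> rdiff f x (g x)) ->
  exists2 c, a <= c <= b & f b - f a = g c * (b - a).
Proof.
move=> ab H.
have [||c] := @MVT_segment R f g a b ab.
- by move=> x; rewrite in_itv /= => /andP[/ltW ? /ltW ?]; apply/rdiffP/H/andP.
- apply: continuous_in_subspaceT => x; rewrite inE /= in_itv /= => xab.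
  exact: rdiff_cont (H x xab).
by rewrite in_itv /= => ? ?; exists c.
Qed.

Lemma rdiffB f g x a b : rdiff f x a -> rdiff g x b -> rdiff (fun y => f y - g y) x (a - b).
Proof.
by move=> /rdiffP H1 /rdiffP H2; apply/rdiffP; exact: is_deriveB.
Qed.

Lemma antiderivative (f : R -> R) a b : continuous f ->
  exists F, forall x, a <= x <= b -> rdiff F x (f x).
Proof.
(* Integrating from [a - 1] makes [a] an interior point, so that the derivative there is
   two-sided. *)
move=> cf; exists (fun x => \int[lebesgue_measure]_(t in `[a - 1, x]) f t).
move=> x /andP[ax xb]; apply/rdiffP.
have xb1 : x < b + 1 by lra.
have ax1 : a - 1 < x by lra.
have fi : lebesgue_measure.-integrable `[a - 1, b + 1] (EFin \o f).
  apply: continuous_compact_integrable; first exact: segment_compact.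
  exact: continuous_subspaceT.
have [dF FE] := continuous_FTC1_closed xb1 fi ax1 (cf x).
by split; [exact: dF | rewrite -derive1E; exact: FE].
Qed.

(** The 1-Lipschitz retraction onto a segment. Composing with it turns a function that is continuous
    at the points of the segment into one that is continuous on the line, as [antiderivative]
    requires. *)
Definition clamp (a b x : R) := Num.min (Num.max x a) b.

Lemma clamp_id a b x : a <= x <= b -> clamp a b x = x.
Proof. by rewrite /clamp => /andP[/max_idPl -> /min_idPl ->]. Qed.

Lemma clamp_in a b x : a <= b -> a <= clamp a b x <= b.
Proof.
by move=> ab; rewrite /clamp ge_min le_min ab le_max !lexx !orbT.
Qed.

Lemma clamp_lip a b x y : a <= b -> `|clamp a b x - clamp a b y| <= `|x - y|.
Proof.
move=> ab; wlog xy : x y / x <= y.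
  by move=> W; case: (leP x y) => [|/ltW]; [|rewrite distrC (distrC x)]; exact: W.
have d0 : 0 <= y - x by lra.
have m1 u v : u <= v -> 0 <= Num.max v a - Num.max u a <= v - u.
  by move=> ?; case: (leP u a) => ?; case: (leP v a) => ?; apply/andP; split; lra.
have m2 u v : u <= v -> 0 <= Num.min v b - Num.min u b <= v - u.
  by move=> ?; case: (leP u b) => ?; case: (leP v b) => ?; apply/andP; split; lra.
rewrite (distrC x) (ger0_norm d0) /clamp.
have /andP[h1 h2] := m1 x y xy; rewrite subr_ge0 in h1.
by have /andP[h3 h4] := m2 _ _ h1; rewrite distrC ger0_norm //; exact: le_trans h4 h2.
Qed.

Lemma antiderivative_in (f : R -> R) a b : a <= b ->
  (forall x, a <= x <= b -> {for x, continuous f}) ->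
  exists F, forall x, a <= x <= b -> rdiff F x (f x).
Proof.
move=> ab cf.
have [|F HF] := @antiderivative (f \o clamp a b) a b.
  move=> x; apply/cvgrPdist_le => e e0.
  have /cvgrPdist_le /(_ e e0) := cf _ (clamp_in x ab).
  move=> [r /= r0 Hr]; exists r => //= y xy; apply: Hr.
  exact: le_lt_trans (clamp_lip _ _ ab) xy.
by exists F => x xab; have := HF x xab; rewrite /= clamp_id.
Qed.

(** Nested intervals: the supremum of the left ends lies in all of them. This drives the bisection
    below and the convergence of geometric Cauchy sequences. *)
Lemma nested_point (a : nat -> R) l :
  (forall n, a n <= a n.+1) ->
  (forall n, a n.+1 + l * 2^-1^+n.+1 <= a n + l * 2^-1^+n) -> 0 <= l ->
  exists u, forall n, a n <= u <= a n + l * 2^-1^+n.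
Proof.
move=> a1 a2 l0.
have m1 : forall n k, a n <= a (n + k)%N.
  move=> n; elim=> [|k IH]; first by rewrite addn0.
  by rewrite addnS; exact: le_trans IH (a1 _).
have m2 : forall n k, a (n + k)%N + l * 2^-1^+(n + k) <= a n + l * 2^-1^+n.
  move=> n; elim=> [|k IH]; first by rewrite addn0.
  by rewrite addnS; exact: le_trans (a2 _) IH.
have p0 : forall n, 0 <= l * 2^-1 ^+ n :> R by move=> n; apply: mulr_ge0 => //; apply: exprn_ge0; lra.
have m3 : forall n k, a k <= a n + l * 2^-1^+n.
  move=> n k; case: (leqP n k) => [nk|/ltnW kn].
    have := m2 n (k - n)%N; rewrite subnKC //; have := p0 k; lra.
  by have := m1 k (n - k)%N; rewrite subnKC //; have := p0 n; lra.
have hs : has_sup (range a).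
  by split; [exists (a 0%N), 0%N | exists (a 0%N + l * 2^-1^+0) => _ [k _ <-]].
exists (sup (range a)) => n; apply/andP; split.
  by apply: (ub_le_sup hs.2); exists n.
by apply: ge_sup => [|_ [k _ <-]]; [exists (a 0%N), 0%N | exact: m3].
Qed.

(** [P x y n] speaks of the rectangle with lower left corner (x, y) whose sides are [lx] and [ly]
    halved n times. A failure of [P] passes to one of the four quarters, again and again; the
    corners converge to a point (u, v), near which the local hypothesis excludes failure. *)
Lemma square_bisection (P : R -> R -> nat -> Prop) x0 lx y0 ly : 0 <= lx -> 0 <= ly ->
  (forall x y n, (forall i j : bool, P (x + i%:R * (lx * 2^-1^+n.+1)) (y + j%:R * (ly * 2^-1^+n.+1)) n.+1) ->
     P x y n) ->
  (forall u v, x0 <= u <= x0 + lx -> y0 <= v <= y0 + ly -> exists N, forall x y,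
     x0 <= x -> x + lx * 2^-1^+N <= x0 + lx -> y0 <= y -> y + ly * 2^-1^+N <= y0 + ly ->
     x <= u <= x + lx * 2^-1^+N -> y <= v <= y + ly * 2^-1^+N -> P x y N) ->
  P x0 y0 0%N.
Proof.
move=> lx0 ly0 step loc; apply: contrapT => nP.
have ch : forall n (z : R * R), exists z' : R * R, ~ P z.1 z.2 n ->
    ~ P z'.1 z'.2 n.+1 /\ exists i j : bool, z' = (z.1 + i%:R * (lx * 2^-1^+n.+1), z.2 + j%:R * (ly * 2^-1^+n.+1)).
  move=> n z; have [H|H] := pselect (P z.1 z.2 n); first by exists z.
  have /existsNP [i /existsNP [j Hij]] : ~ (forall i j : bool, P (z.1 + i%:R * (lx * 2^-1^+n.+1)) (z.2 + j%:R * (ly * 2^-1^+n.+1)) n.+1).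
    by move=> K; apply: H; apply: step.
  by exists (z.1 + i%:R * (lx * 2^-1^+n.+1), z.2 + j%:R * (ly * 2^-1^+n.+1)) => _; split => //; exists i, j.
have [f Hf] : {f : nat -> R * R -> R * R & forall n z, ~ P z.1 z.2 n ->
    ~ P (f n z).1 (f n z).2 n.+1 /\ exists i j : bool, f n z = (z.1 + i%:R * (lx * 2^-1^+n.+1), z.2 + j%:R * (ly * 2^-1^+n.+1))}.
  exists (fun n z => projT1 (cid (ch n z))) => n z; exact: projT2 (cid (ch n z)).
pose s := fix s n := if n is n'.+1 then f n' (s n') else (x0, y0).
have sP : forall n, ~ P (s n).1 (s n).2 n by elim=> [//|n IH]; exact: (Hf n _ IH).1.
have sS : forall n, exists i j : bool, s n.+1 = ((s n).1 + i%:R * (lx * 2^-1^+n.+1), (s n).2 + j%:R * (ly * 2^-1^+n.+1)).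
  by move=> n; exact: (Hf n _ (sP n)).2.
have half (l : R) n : 0 <= l -> 0 <= l * 2^-1^+n.+1 /\ l * 2^-1^+n = 2 * (l * 2^-1^+n.+1).
  move=> l0; split; first by apply: mulr_ge0 => //; apply: exprn_ge0; lra.
  by rewrite exprS; field.
have aux n : ((s n).1 <= (s n.+1).1) /\ ((s n.+1).1 + lx * 2^-1^+n.+1 <= (s n).1 + lx * 2^-1^+n) /\
    ((s n).2 <= (s n.+1).2) /\ ((s n.+1).2 + ly * 2^-1^+n.+1 <= (s n).2 + ly * 2^-1^+n).
  have [i [j ->]] := sS n; have [? e1] := half lx n lx0; have [? e2] := half ly n ly0.
  rewrite e1 e2 /=; by case: i; case: j => /=; lra.
have [u Hu] := @nested_point (fun n => (s n).1) lx (fun n => (aux n).1) (fun n => (aux n).2.1) lx0.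
have [v Hv] := @nested_point (fun n => (s n).2) ly (fun n => (aux n).2.2.1) (fun n => (aux n).2.2.2) ly0.
have [||N HN] := loc u v.
- by have := Hu 0%N; rewrite expr0 mulr1.
- by have := Hv 0%N; rewrite expr0 mulr1.
apply: (sP N).
have [b1 [b2 [b3 b4]]] : x0 <= (s N).1 /\ (s N).1 + lx * 2^-1^+N <= x0 + lx /\
    y0 <= (s N).2 /\ (s N).2 + ly * 2^-1^+N <= y0 + ly.
  elim: (N) => [|n IH]; first by rewrite /= !expr0 !mulr1 !lexx.
  have := aux n; lra.
by apply: HN.
Qed.

Definition frechet2 (p : R -> R -> R) (x y A B : R) := forall e, 0 < e -> exists2 d, 0 < d &
  forall h k, `|h| < d -> `|k| < d ->
    `|p (x + h) (y + k) - p x y - A * h - B * k| <= e * (`|h| + `|k|).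

Lemma frechet2_cont1 p x y A B : frechet2 p x y A B -> {for x, continuous (p^~ y)}.
Proof.
move=> H; apply: (@rdiff_cont _ _ A) => e e0; have [d d0 Hd] := H e e0; exists d => // h hd.
have := Hd h 0 hd; rewrite normr0 !addr0 mulr0 subr0; exact.
Qed.

Lemma frechet2_cont2 p x y A B : frechet2 p x y A B -> {for y, continuous (p x)}.
Proof.
move=> H; apply: (@rdiff_cont _ _ B) => e e0; have [d d0 Hd] := H e e0; exists d => // h hd.
have := Hd 0 h; rewrite normr0 !addr0 mulr0 subr0 add0r; exact.
Qed.

Lemma pow_half_lt (l d : R) : 0 < d -> exists N, l * 2^-1^+N < d.
Proof.
move=> d0; have [N HN] : exists N : nat, `|l| / d < N%:R.
  by exists (Num.bound (`|l| / d)); apply: archi_boundP; apply: divr_ge0; [|lra].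
exists N; have N2 : N%:R <= 2 ^+ N :> R.
  by rewrite -natrX ler_nat; apply: ltnW; apply: ltn_expl.
have p2 : 0 < 2 ^+ N :> R by apply: exprn_gt0.
rewrite exprVn ltr_pdivrMr //; apply: le_lt_trans (ler_norm _) _.
rewrite ltr_pdivrMr // in HN; apply: lt_le_trans HN _.
by rewrite mulrC ler_pM2l.
Qed.

Lemma bound_inside (x u w l d : R) : x <= u <= x + l -> x <= w <= x + l -> l < d ->
  `|w - u| <= l /\ `|w - u| < d.
Proof.
move=> /andP[? ?] /andP[? ?] ?.
have H : `|w - u| <= l by rewrite ler_norml; lra.
by split => //; exact: le_lt_trans H _.
Qed.

(* For a 1-form [p dx + q dy] that is closed in the sense of pointwise
   derivatives only, the boundary integral of a rectangle is an additive
   function of the rectangle, so Goursat's bisection shows that it is 0. *)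
Lemma goursat (p q : R -> R -> R) x0 lx y0 ly : 0 < lx -> 0 < ly ->
  (forall x y, x0 <= x <= x0 + lx -> y0 <= y <= y0 + ly ->
     exists A B D, frechet2 p x y A B /\ frechet2 q x y B D) ->
  (forall x, x0 <= x <= x0 + lx -> p x (y0 + ly) = p x y0) ->
  exists2 y, y0 <= y <= y0 + ly & q (x0 + lx) y = q x0 y.
Proof.
move=> lx0 ly0 H per.
have chQ x : exists Qx, x0 <= x <= x0 + lx -> forall y, y0 <= y <= y0 + ly -> rdiff Qx y (q x y).
  have [xi|] := boolP (x0 <= x <= x0 + lx); last by exists (fun=> 0).
  have [||F HF] := @antiderivative_in (q x) y0 (y0 + ly); [lra| |by exists F].
  by move=> y yi; have [A [B [D [_ h]]]] := H x y xi yi; exact: frechet2_cont2 h.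
have chP y : exists Py, y0 <= y <= y0 + ly -> forall x, x0 <= x <= x0 + lx -> rdiff Py x (p x y).
  have [yi|] := boolP (y0 <= y <= y0 + ly); last by exists (fun=> 0).
  have [||F HF] := @antiderivative_in (p^~ y) x0 (x0 + lx); [lra| |by exists F].
  by move=> x xi; have [A [B [D [h _]]]] := H x y xi yi; exact: frechet2_cont1 h.
have [Q HQ] := choice chQ; have [P HP] := choice chP.
(* The counterclockwise integral of p dx + q dy over the boundary of [a, b] x [c, d]. Written with
   antiderivatives, it is visibly additive when the rectangle is cut. *)
pose J a b c d := (Q b d - Q b c - Q a d + Q a c) - (P d b - P d a - P c b + P c a).
have J0 : forall eta, 0 < eta -> `|J x0 (x0 + lx) y0 (y0 + ly)| <= eta.
  move=> eta eta0.
  pose S x y n := `|J x (x + lx * 2^-1^+n) y (y + ly * 2^-1^+n)| <= eta * 4^-1^+n.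
  have : S x0 y0 0%N; last by rewrite /S !expr0 !mulr1.
  apply: (@square_bisection S x0 lx y0 ly); [lra|lra| |].
    move=> x y n K.
    have := K false false; have := K false true; have := K true false; have := K true true.
    rewrite /S /= !mul0r !mul1r !addr0.
    have -> : lx * 2^-1^+n = lx * 2^-1^+n.+1 + lx * 2^-1^+n.+1 by rewrite exprS; field.
    have -> : ly * 2^-1^+n = ly * 2^-1^+n.+1 + ly * 2^-1^+n.+1 by rewrite exprS; field.
    have -> : eta * 4^-1^+n = 4 * (eta * 4^-1^+n.+1) by rewrite exprS; field.
    move: (lx * _) (ly * _) (eta * _ ) => a b c.
    rewrite !addrA !ler_norml /J => *; lra.
  move=> u v ui vi; have [A [B [D [hp hq]]]] := H u v ui vi.
  pose L := lx + ly; have L0 : 0 < L by rewrite /L; lra.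
  (* On a rectangle with sides a and b near (u, v), the linear parts cancel and the error is at most
     2 e (a + b)^2. For a + b = L 2^-N this is eta 4^-N. *)
  pose e := eta / (2 * L ^+ 2).
  have e0 : 0 < e by apply: divr_gt0 => //; apply: mulr_gt0 => //; apply: exprn_gt0.
  have [d1 d10 H1] := hp e e0; have [d2 d20 H2] := hq e e0.
  have mn0 : 0 < Num.min d1 d2 by rewrite lt_min d10.
  have [N HN] := pow_half_lt L mn0.
  exists N => x y xa xb ya yb xu yv; rewrite /S.
  have t0 : 0 < 2^-1^+N :> R by apply: exprn_gt0; lra.
  have := HN; rewrite [in X in X -> _]/L [in X in X -> _]mulrDl lt_min.
  have -> : eta * 4^-1^+N = 2 * e * (lx * 2^-1^+N + ly * 2^-1^+N)^+2.
    rewrite -mulrDl -/L exprMn -exprM mulnC exprM.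
    have -> : 2^-1^+2 = 4^-1 :> R by field.
    by rewrite /e; field; apply: lt0r_neq0.
  have a0 : 0 < lx * 2^-1^+N by apply: mulr_gt0.
  have b0 : 0 < ly * 2^-1^+N by apply: mulr_gt0.
  move: (lx * 2^-1^+N) (ly * 2^-1^+N) a0 b0 xb yb xu yv => a b a0 b0 xb yb xu yv /andP[ab1 ab2].
  have [xa1 xa2] : x0 <= x <= x0 + lx /\ x0 <= x + a <= x0 + lx by split; lra.
  have [ya1 ya2] : y0 <= y <= y0 + ly /\ y0 <= y + b <= y0 + ly by split; lra.
  have [xi xin Ex] := @rdiff_mvt (fun t => P (y + b) t - P y t) (fun t => p t (y + b) - p t y) x (x + a)
     ltac:(lra) (fun t ti => rdiffB (HP _ ya2 t ltac:(lra)) (HP _ ya1 t ltac:(lra))).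
  have [et etn Ey] := @rdiff_mvt (fun t => Q (x + a) t - Q x t) (fun t => q (x + a) t - q x t) y (y + b)
     ltac:(lra) (fun t ti => rdiffB (HQ _ xa2 t ltac:(lra)) (HQ _ xa1 t ltac:(lra))).
  have Fp w z : x <= w <= x + a -> y <= z <= y + b ->
      `|p w z - p u v - A * (w - u) - B * (z - v)| <= e * (a + b).
    move=> wi zi; have [? ?] := bound_inside xu wi (ltac:(lra) : a < d1).
    have [? ?] := bound_inside yv zi (ltac:(lra) : b < d1).
    have := H1 (w - u) (z - v); rewrite !subrKC => /(_ _ _)/le_trans; apply => //.
    by rewrite ler_pM2l // lerD.
  have Fq w z : x <= w <= x + a -> y <= z <= y + b ->
      `|q w z - q u v - B * (w - u) - D * (z - v)| <= e * (a + b).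
    move=> wi zi; have [? ?] := bound_inside xu wi (ltac:(lra) : a < d2).
    have [? ?] := bound_inside yv zi (ltac:(lra) : b < d2).
    have := H2 (w - u) (z - v); rewrite !subrKC => /(_ _ _)/le_trans; apply => //.
    by rewrite ler_pM2l // lerD.
  have -> : J x (x + a) y (y + b) = (q (x + a) et - q x et - B * a) * b - (p xi (y + b) - p xi y - B * b) * a.
    have -> : J x (x + a) y (y + b) = (Q (x + a) (y + b) - Q x (y + b) - (Q (x + a) y - Q x y))
      - (P (y + b) (x + a) - P y (x + a) - (P (y + b) x - P y x)) by rewrite /J; ring.
    by rewrite Ey Ex; ring.
  have K1 : `|q (x + a) et - q x et - B * a| <= 2 * (e * (a + b)).
    have := Fq (x + a) et ltac:(lra) etn; have := Fq x et ltac:(lra) etn.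
    rewrite !ler_norml; lra.
  have K2 : `|p xi (y + b) - p xi y - B * b| <= 2 * (e * (a + b)).
    have := Fp xi (y + b) xin ltac:(lra); have := Fp xi y xin ltac:(lra).
    rewrite !ler_norml; lra.
  apply: le_trans (ler_normB _ _) _; rewrite !normrM (gtr0_norm a0) (gtr0_norm b0).
  apply: le_trans (lerD (ler_wpM2r (ltW b0) K1) (ler_wpM2r (ltW a0) K2)) _.
  by rewrite le_eqVlt; apply/orP; left; apply/eqP; ring.
have Jz : J x0 (x0 + lx) y0 (y0 + ly) = 0.
  apply/eqP; rewrite -normr_le0; apply/ler_addgt0Pr => eta eta0.
  by rewrite add0r; exact: J0.
have xI1 : x0 <= x0 <= x0 + lx by lra.
have xI2 : x0 <= x0 + lx <= x0 + lx by lra.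
have yI1 : y0 <= y0 <= y0 + ly by lra.
have yI2 : y0 <= y0 + ly <= y0 + ly by lra.
have [xi xin Ex] := @rdiff_mvt (fun t => P (y0 + ly) t - P y0 t) (fun t => p t (y0 + ly) - p t y0) x0 (x0 + lx)
     ltac:(lra) (fun t ti => rdiffB (HP _ yI2 t ti) (HP _ yI1 t ti)).
have [et etn Ey] := @rdiff_mvt (fun t => Q (x0 + lx) t - Q x0 t) (fun t => q (x0 + lx) t - q x0 t) y0 (y0 + ly)
     ltac:(lra) (fun t ti => rdiffB (HQ _ xI2 t ti) (HQ _ xI1 t ti)).
exists et => //.
(* Equal values of [p] on bottom and top cancel the horizontal sides; the difference of [q] on the
   vertical sides then has integral 0 and vanishes at the mean value point. *)
move: Ex Ey Jz; rewrite per // subrr mul0r /J => Ex Ey Jz.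
have : (q (x0 + lx) et - q x0 et) * (y0 + ly - y0) = 0.
  by rewrite -Ey; lra.
by move=> /eqP; rewrite mulf_eq0 => /orP[|]; rewrite ?subr_eq0 => /eqP //; lra.
Qed.

End RealCalculus.

(** * Complex derivatives, the exponential and Cauchy's inequality *)

Section ComplexCalculus.
Variable R : realType.
Local Notation C := R[i].
Local Notation Re := (@complex.Re R).
Local Notation Im := (@complex.Im R).
Implicit Types (z w d : C) (f g : C -> C).

(** The modulus as an element of [R]: the norm [|z|] takes its values in [R[i]], whose order is only
    partial. *)
Definition nc z : R := ComplexField.Normc.normc z.

Lemma nc_norm z : `|z| = (nc z)%:C%C. Proof. by []. Qed.
Lemma nc_ge0 z : 0 <= nc z. Proof. by case: z => a b; exact: sqrtr_ge0. Qed.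
Lemma nc0 : nc 0 = 0. Proof. exact: ComplexField.Normc.normc0. Qed.
Lemma nc1 : nc 1 = 1. Proof. exact: ComplexField.Normc.normc1. Qed.
Lemma nc_eq0 z : (nc z == 0) = (z == 0).
Proof.
by apply/eqP/eqP => [/ComplexField.Normc.eq0_normc|->]; [|exact: nc0].
Qed.
Lemma nc_gt0 z : (0 < nc z) = (z != 0).
Proof. by rewrite lt_def nc_ge0 andbT nc_eq0. Qed.
Lemma ncM z w : nc (z * w) = nc z * nc w.
Proof. exact: ComplexField.Normc.normcM. Qed.
Lemma ncD z w : nc (z + w) <= nc z + nc w.
Proof. exact: (@le_normcD R z w). Qed.
Lemma ncN z : nc (- z) = nc z.
Proof. exact: (@normcN R z). Qed.
Lemma ncBC z w : nc (z - w) = nc (w - z).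
Proof. by rewrite -ncN opprB. Qed.
Lemma ncB z w : nc (z - w) <= nc z + nc w.
Proof. by apply: le_trans (ncD _ _) _; rewrite ncN. Qed.
Lemma ncV z : nc z^-1 = (nc z)^-1.
Proof. exact: ComplexField.Normc.normcV. Qed.
Lemma ncX z n : nc (z ^+ n) = nc z ^+ n.
Proof. by elim: n => [|n IH]; rewrite ?expr0 ?nc1 // !exprS ncM IH. Qed.
Lemma ncR (x : R) : nc x%:C%C = `|x|.
Proof. by rewrite /nc /= expr0n /= addr0 sqrtr_sqr. Qed.
Lemma nc_nat n : nc n%:R = n%:R.
Proof. by rewrite -(rmorph_nat (real_complex R)) ncR normr_nat. Qed.
Lemma ler_Re_nc z : `|Re z| <= nc z.
Proof.
by case: z => a b; rewrite /nc /= -sqrtr_sqr ler_wsqrtr // lerDl sqr_ge0.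
Qed.
Lemma ler_Im_nc z : `|Im z| <= nc z.
Proof.
by case: z => a b; rewrite /nc /= -sqrtr_sqr ler_wsqrtr // lerDr sqr_ge0.
Qed.
Lemma nc_le_ReIm z : nc z <= `|Re z| + `|Im z|.
Proof.
rewrite {1}[z]complexE; apply: le_trans (ncD _ _) _.
rewrite ncM !ncR (_ : nc _ = 1) ?mul1r // /nc /= expr0n /= add0r expr1n sqrtr1 //.
Qed.
Lemma nc_sum I (s : seq I) (P : pred I) (F : I -> C) :
  nc (\sum_(i <- s | P i) F i) <= \sum_(i <- s | P i) nc (F i).
Proof.
elim/big_ind2: _ => //; first by rewrite nc0.
by move=> z x w y H1 H2; exact: le_trans (ncD _ _) (lerD H1 H2).
Qed.
Lemma nc_prod I (s : seq I) (P : pred I) (F : I -> C) :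
  nc (\prod_(i <- s | P i) F i) = \prod_(i <- s | P i) nc (F i).
Proof. by apply: (big_morph nc ncM nc1). Qed.
Lemma ReB z w : Re (z - w) = Re z - Re w. Proof. by case: z; case: w. Qed.
Lemma ImB z w : Im (z - w) = Im z - Im w. Proof. by case: z; case: w. Qed.
Lemma ReD z w : Re (z + w) = Re z + Re w. Proof. by case: z; case: w. Qed.
Lemma ImD z w : Im (z + w) = Im z + Im w. Proof. by case: z; case: w. Qed.

Definition cdiff f z d := forall e, 0 < e -> exists2 r, 0 < r &
  forall w, nc w < r -> nc (f (z + w) - f z - d * w) <= e * nc w.

Lemma cdiff_lip f z d : cdiff f z d -> exists2 r, 0 < r &
  forall w, nc w < r -> nc (f (z + w) - f z) <= (nc d + 1) * nc w.
Proof.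
move=> /(_ 1 ltr01) [r r0 H]; exists r => // w /H K.
rewrite -(subrK (d * w) (_ - _)); apply: le_trans (ncD _ _) _.
by rewrite ncM mulrDl addrC lerD2l.
Qed.

Lemma cdiff_cst c z : cdiff (fun=> c) z 0.
Proof.
by move=> e e0; exists 1 => // w _; rewrite mul0r !subrr nc0 mulr_ge0 ?nc_ge0 // ltW.
Qed.

Lemma cdiff_id z : cdiff id z 1.
Proof.
move=> e e0; exists 1 => // w _; have -> : z + w - z - 1 * w = 0 by ring.
by rewrite nc0 mulr_ge0 ?nc_ge0 // ltW.
Qed.

Lemma cdiffD f g z a b : cdiff f z a -> cdiff g z b -> cdiff (fun x => f x + g x) z (a + b).
Proof.
move=> H1 H2 e e0; have e2 : 0 < e / 2 by rewrite divr_gt0.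
have [r r0 K1] := H1 _ e2; have [s s0 K2] := H2 _ e2.
exists (Num.min r s) => [|w]; first by rewrite lt_min r0.
rewrite lt_min => /andP[/K1 L1 /K2 L2].
have -> : f (z + w) + g (z + w) - (f z + g z) - (a + b) * w =
  (f (z + w) - f z - a * w) + (g (z + w) - g z - b * w) by ring.
by apply: le_trans (ncD _ _) _; apply: le_trans (lerD L1 L2) _; rewrite -mulrDl -splitr.
Qed.

Lemma cdiff_comp f g z a b : cdiff f z a -> cdiff g (f z) b -> cdiff (g \o f) z (b * a).
Proof.
move=> H1 H2 e e0.
have n1 : 0 < nc a + 1 by have := nc_ge0 a; lra.
have n2 : 0 < nc b + 1 by have := nc_ge0 b; lra.
have e1 : 0 < e / 2 / (nc a + 1) by rewrite !divr_gt0.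
have e2 : 0 < e / 2 / (nc b + 1) by rewrite !divr_gt0.
have [r r0 K1] := H1 _ e2; have [s s0 K2] := H2 _ e1; have [t t0 K3] := cdiff_lip H1.
exists (Num.min (Num.min r t) (s / (nc a + 1))) => [|w].
  by rewrite !lt_min r0 t0 divr_gt0.
rewrite !lt_min => /andP[/andP[/K1 L1 /K3 L3] ws].
have L2 := K2 (f (z + w) - f z) _; rewrite subrKC in L2.
have -> : (g \o f) (z + w) - (g \o f) z - b * a * w =
  (g (f (z + w)) - g (f z) - b * (f (z + w) - f z)) + b * (f (z + w) - f z - a * w) by rewrite /=; ring.
apply: le_trans (ncD _ _) _; rewrite ncM.
have {}L2 := L2 _; apply: le_trans (lerD (L2 _) (ler_wpM2l (nc_ge0 b) L1)) _.
  by apply: le_lt_trans L3 _; rewrite mulrC -ltr_pdivlMr.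
apply: le_trans (lerD (ler_wpM2l (ltW e1) L3) (lexx _)) _.
have -> : e / 2 / (nc a + 1) * ((nc a + 1) * nc w) = e / 2 * nc w by field; apply: lt0r_neq0.
have -> : nc b * (e / 2 / (nc b + 1) * nc w) = nc b / (nc b + 1) * (e / 2 * nc w) by field; apply: lt0r_neq0.
have w0 : 0 <= e / 2 * nc w by rewrite mulr_ge0 ?nc_ge0 // ltW // divr_gt0.
have : nc b / (nc b + 1) <= 1 by rewrite ler_pdivrMr //; lra.
by move=> /(ler_wpM2r w0); lra.
Qed.

Lemma cdiffM f g z a b : cdiff f z a -> cdiff g z b ->
  cdiff (fun x => f x * g x) z (a * g z + f z * b).
Proof.
move=> H1 H2 e e0; have [t t0 K3] := cdiff_lip H1.
have [A A0 [hA1 [hA2 hA3]]] : exists2 A, 0 < A & nc (f z) <= A /\ nc (g z) <= A /\ nc a + 1 <= A.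
  exists (nc (f z) + nc (g z) + nc a + 1); have := nc_ge0 (f z); have := nc_ge0 (g z); have := nc_ge0 a; lra.
have [s s0 K4] := cdiff_lip H2.
have e1 : 0 < e / 3 / A by rewrite !divr_gt0.
have [r r0 K1] := H1 _ e1; have [q q0 K2] := H2 _ e1.
pose B := A * (nc b + 1).
have B0 : 0 < B by rewrite mulr_gt0 //; have := nc_ge0 b; lra.
exists (Num.min (Num.min r t) (Num.min (Num.min q s) (e / 3 / B))) => [|w].
  by rewrite !lt_min r0 t0 q0 s0 !divr_gt0.
rewrite !lt_min => /andP[/andP[/K1 L1 /K3 L3] /andP[/andP[/K2 L2 /K4 L4] we]].
have -> : f (z + w) * g (z + w) - f z * g z - (a * g z + f z * b) * w =
  (f (z + w) - f z - a * w) * g z + f z * (g (z + w) - g z - b * w)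
  + (f (z + w) - f z) * (g (z + w) - g z) by ring.
apply: le_trans (ncD _ _) _; apply: le_trans (lerD (ncD _ _) (lexx _)) _; rewrite !ncM.
have M1 := ler_pM (nc_ge0 _) (nc_ge0 _) L1 hA2.
have M2 := ler_pM (nc_ge0 _) (nc_ge0 _) hA1 L2.
have M3 := ler_pM (nc_ge0 _) (nc_ge0 _) L3 L4.
apply: le_trans (lerD (lerD M1 M2) M3) _.
have -> : e / 3 / A * nc w * A + A * (e / 3 / A * nc w) = 2 * (e / 3 * nc w).
  by field; apply: lt0r_neq0.
have : (nc a + 1) * nc w * ((nc b + 1) * nc w) <= e / 3 * nc w.
  rewrite mulrA ler_wpM2r ?nc_ge0 //.
  have : nc w * B <= e / 3 by rewrite -ler_pdivlMr // ltW.
  apply: le_trans; have -> : nc w * B = A * (nc w * (nc b + 1)) by rewrite /B; ring.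
  by rewrite -mulrA ler_wpM2r // mulr_ge0 ?nc_ge0 //; have := nc_ge0 b; lra.
lra.
Qed.

Lemma cdiffV z : z != 0 -> cdiff (fun x => x^-1) z (- (z^-1 * z^-1)).
Proof.
move=> z0 e e0; have n0 : 0 < nc z by rewrite nc_gt0.
exists (Num.min (nc z / 2) (e * nc z ^+ 3 / 2)) => [|w].
  by rewrite lt_min divr_gt0 //= divr_gt0 // mulr_gt0 // exprn_gt0.
rewrite lt_min => /andP[w1 w2].
have n1 : nc z / 2 <= nc (z + w).
  have := ncB (z + w) w; rewrite addrK; lra.
have zw0 : z + w != 0 by rewrite -nc_gt0; lra.
have -> : (z + w)^-1 - z^-1 - - (z^-1 * z^-1) * w = (z ^+ 2 * (z + w))^-1 * w * w.
  by field; rewrite z0 zw0.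
rewrite !ncM ncV ler_wpM2r ?nc_ge0 // ncM ncX mulrC.
have n3 : 0 < nc z ^+ 2 * nc (z + w) by rewrite mulr_gt0 ?exprn_gt0 // nc_gt0.
rewrite ler_pdivrMr //; apply: le_trans (ltW w2) _.
rewrite -mulrA ler_pM2l // exprSr -mulrA ler_pM2l ?exprn_gt0 //.
Qed.

Lemma cdiff_eq f g z d : (forall x, f x = g x) -> cdiff f z d -> cdiff g z d.
Proof. by move=> fg H e /H[r r0 K]; exists r => // w /K; rewrite !fg. Qed.

Lemma cdiffMl c f z a : cdiff f z a -> cdiff (fun x => c * f x) z (c * a).
Proof. by move=> H; have := cdiffM (cdiff_cst c z) H; rewrite mul0r add0r. Qed.

Lemma cdiffN f z a : cdiff f z a -> cdiff (fun x => - f x) z (- a).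
Proof.
move=> H; rewrite -mulN1r; apply: (cdiff_eq (f := fun x => -1 * f x)).
  by move=> x; rewrite mulN1r.
exact: cdiffMl.
Qed.

(** The Cauchy-Riemann equations. The common entry [Re d] makes Im f dx + Re f dy a closed form in
    the sense of [goursat]. *)
Lemma cdiff_frechet2 f (x y : R) d : cdiff f (x +i* y)%C d ->
  frechet2 (fun s t => Re (f (s +i* t)%C)) x y (Re d) (- Im d) /\
  frechet2 (fun s t => Im (f (s +i* t)%C)) x y (Im d) (Re d).
Proof.
move=> H; suff K : forall e, 0 < e -> exists2 r, 0 < r & forall h k, `|h| < r -> `|k| < r ->
    nc (f ((x + h) +i* (y + k))%C - f (x +i* y)%C - d * (h +i* k)%C) <= e * (`|h| + `|k|).
  split=> e /K[r r0 {}K]; exists r => // h k hr kr; apply: le_trans (K h k hr kr).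
    apply: le_trans (ler_Re_nc _); rewrite !ReB; case: (d) => a b /=.
    by rewrite le_eqVlt; apply/orP; left; apply/eqP; congr (`|_|); ring.
  apply: le_trans (ler_Im_nc _); rewrite !ImB; case: (d) => a b /=.
  by rewrite le_eqVlt; apply/orP; left; apply/eqP; congr (`|_|); ring.
move=> e e0; have [r r0 {}H] := H e e0; exists (r / 2); first by rewrite divr_gt0.
move=> h k hr kr; have hk := nc_le_ReIm (h +i* k)%C; rewrite /= in hk.
have := H (h +i* k)%C; rewrite [(x +i* y + _)%C]/(_ + _) /= => /(_ _)/le_trans; apply; first by lra.
by rewrite ler_pM2l.
Qed.

Definition cexp z : C := (expR (Re z) * cos (Im z) +i* (expR (Re z) * sin (Im z)))%C.

Lemma cexpD z w : cexp (z + w) = cexp z * cexp w.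
Proof.
rewrite /cexp ReD ImD expRD cosD sinD.
case: z => a b; case: w => c d /=; apply/eqP; rewrite eq_complex /=.
by apply/andP; split; apply/eqP; ring.
Qed.

Lemma nc_cexp z : nc (cexp z) = expR (Re z).
Proof.
rewrite /nc /cexp /= !exprMn -mulrDr cos2Dsin2 mulr1 sqrtr_sqr ger0_norm //; exact: expR_ge0.
Qed.

Lemma cexp0 : cexp 0 = 1.
Proof. by rewrite /cexp /= expR0 cos0 sin0 mulr1 mulr0. Qed.

Lemma cexp_neq0 z : cexp z != 0.
Proof. by rewrite -nc_gt0 nc_cexp expR_gt0. Qed.

Lemma cexpN z : cexp (- z) = (cexp z)^-1.
Proof.
by apply: (mulIf (cexp_neq0 z)); rewrite -cexpD addNr cexp0 mulVf // cexp_neq0.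
Qed.

Lemma cdiff_cexp0 : cdiff cexp 0 1.
Proof.
(* The real part of the error will be at most 3 e' |w| and the imaginary part at most 4 e' |w|, so e
   / 8 is enough; the bound 1/2 gives exp (Re w) <= 2. *)
move=> e e0; have [e' e'0 [e1 e2]] : exists2 e', 0 < e' & e' <= e / 8 /\ e' <= 2^-1.
  exists (Num.min (e / 8) 2^-1); first by rewrite lt_min divr_gt0 //= invr_gt0.
  by rewrite !ge_min !lexx orbT.
have [r1 r10 H1] := (rdiffP expR 0 (expR 0)).2 (is_derive_expR 0) e' e'0.
have [r2 r20 H2] := (rdiffP sin (0:R) (cos 0)).2 (is_derive_sin 0) e' e'0.
have [r3 r30 H3] := (rdiffP cos (0:R) (- sin 0)).2 (is_derive_cos 0) e' e'0.
exists (Num.min (Num.min r1 r2) (Num.min r3 e')) => [|w].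
  by rewrite lt_min; apply/andP; split; rewrite lt_min ?r10 ?r30 /=; [exact: r20 | exact: e'0].
rewrite !lt_min => /andP[/andP[w1 w2] /andP[w3 w4]].
have hx := ler_Re_nc w; have hy := ler_Im_nc w.
have := H1 (Re w) (le_lt_trans hx w1); have := H2 (Im w) (le_lt_trans hy w2).
have := H3 (Im w) (le_lt_trans hy w3).
rewrite !add0r expR0 cos0 sin0 oppr0 !mul1r mul0r !subr0 ?addr0 => K3 K2 K1.
rewrite cexp0.
have E : cexp w - 1 - w = Complex ((expR (Re w) - 1 - Re w) + expR (Re w) * (cos (Im w) - 1))
   (expR (Re w) * (sin (Im w) - Im w) + (expR (Re w) - 1) * Im w).
  case: (w) => a b; rewrite /cexp; apply/eqP; rewrite eq_complex /=.
  by apply/andP; split; apply/eqP; ring.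
rewrite E; apply: le_trans (nc_le_ReIm _) _ => /=; clear E w1 w2 w3 H1 H2 H3 r10 r20 r30.
move: hx hy w4 K1 K2 K3; set N := nc w; set X := expR _; set x := Re w; set y := Im w.
set c := cos y; set s := sin y => hx hy w4 K1 K2 K3.
have X0 : 0 <= X by exact: expR_ge0.
have N0 : 0 <= N by exact: nc_ge0.
have X1 : `|X - 1| <= 2 * `|x|.
  have -> : X - 1 = (X - 1 - x) + x by ring.
  apply: le_trans (ler_normD _ _) _; apply: le_trans (lerD K1 (lexx _)) _.
  have := ler_wpM2r (normr_ge0 x) e2; have := normr_ge0 x; lra.
have X2 : X <= 2 by have := ler_norm (X - 1); lra.
have eN1 : e' * `|x| <= e' * N by rewrite ler_pM2l.
have eN2 : e' * `|y| <= e' * N by rewrite ler_pM2l.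
have A1 : `|X - 1 - x + X * (c - 1)| <= 3 * (e' * N).
  apply: le_trans (ler_normD _ _) _; rewrite normrM (ger0_norm X0).
  have := ler_pM X0 (normr_ge0 _) X2 K3; lra.
have A2 : `|X * (s - y) + (X - 1) * y| <= 4 * (e' * N).
  apply: le_trans (ler_normD _ _) _; rewrite !normrM (ger0_norm X0).
  have := ler_pM X0 (normr_ge0 _) X2 K2.
  have : 2 * `|x| * `|y| <= 2 * (e' * N).
    rewrite -mulrA ler_pM2l // ler_pM //; lra.
  have := ler_wpM2r (normr_ge0 y) X1; lra.
have : e' * N <= e / 8 * N by rewrite ler_wpM2r.
have := mulr_ge0 (ltW e0) N0; lra.
Qed.

Lemma cdiff_cexp z : cdiff cexp z (cexp z).
Proof.
move=> e e0; have e1 : 0 < e / nc (cexp z) by rewrite divr_gt0 // nc_gt0 cexp_neq0.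
have [r r0 H] := cdiff_cexp0 e1; exists r => // w /H; rewrite add0r cexp0 mul1r cexpD => K.
have -> : cexp z * cexp w - cexp z - cexp z * w = (cexp w - 1 - w) * cexp z by ring.
by rewrite ncM; move: K; rewrite mulrAC ler_pdivlMr // nc_gt0 cexp_neq0.
Qed.

Lemma cexp_period (x y : R) : cexp (x +i* (y + 2 * pi))%C = cexp (x +i* y)%C.
Proof. by rewrite /cexp /= mulr_natl cosD2pi sinD2pi. Qed.

(* With [H z := (g (a + e^z) - g a) / e^z], whose real part tends to [Re d] as
   [Re z] tends to minus infinity, Goursat on a rectangle of height [2 pi]
   compares the values of [Re H] on its two vertical sides. *)
Lemma cauchy_inequality (g : C -> C) (a d : C) (r M : R) : 0 < r ->
  (forall z, nc (z - a) <= r -> exists d', cdiff g z d') ->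
  (forall z, nc (z - a) <= r -> nc (g z) <= M) ->
  cdiff g a d -> nc d <= 2 * M / r.
Proof.
move=> r0 Hd HM Hda; rewrite leNgt; apply/negP => bad.
have M0 : 0 <= M by apply: le_trans (nc_ge0 (g a)) (HM a _); rewrite subrr nc0 ltW.
have d0 : 0 < nc d by apply: le_lt_trans bad; rewrite divr_ge0 ?mulr_ge0 // ltW.
(* Half of the supposed gap. [Re H] will be at least [nc d - eps] on the left side and at most
   [2 * M / r] on the right side, yet the two agree at some height. *)
pose eps := (nc d - 2 * M / r) / 2.
have eps0 : 0 < eps by rewrite divr_gt0 // subr_gt0.
have dn0 : d != 0 by rewrite -nc_gt0.
(* A rotation that makes the derivative real and positive, so that real parts suffice. *)
pose c := (nc d)%:C%C / d.
have ncc : nc c = 1 by rewrite ncM ncV ncR ger0_norm ?nc_ge0 // divff // nc_eq0.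
have cd : c * d = (nc d)%:C%C by rewrite /c mulfVK.
have [del del0 Hdel] := Hda eps eps0.
(* The exponential maps the right side onto the circle of radius r around 0, and the left side into
   the disc on which the difference quotient is [eps]-close to d. *)
pose s1 := ln r; pose s0 := Num.min (ln (del / 2)) (s1 - 1).
have s01 : s0 < s1 by rewrite gt_min; apply/orP; right; lra.
have E1 : expR s1 = r by apply: lnK; rewrite posrE.
have E0 : expR s0 < del.
  apply: (@le_lt_trans _ _ (expR (ln (del / 2)))); first by rewrite ler_expR ge_min lexx.
  by rewrite lnK ?posrE ?divr_gt0 //; lra.
pose H z := c * ((g (a + cexp z) - g a) * cexp (- z)).
have hdiff z : Re z <= s1 -> exists d', cdiff H z d'.
  move=> zs; have [|d1 K1] := Hd (a + cexp z).
    by rewrite addrC addKr nc_cexp -E1 ler_expR.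
  have K2 : cdiff (fun x => a + cexp x) z (0 + cexp z) by apply: cdiffD (cdiff_cst _ _) (cdiff_cexp z).
  have K3 := cdiffD (cdiff_comp K2 K1) (cdiff_cst (- g a) z).
  have K4 := cdiff_comp (cdiffN (cdiff_id z)) (cdiff_cexp (- z)).
  have K5 := cdiffMl c (cdiffM K3 K4).
  by eexists; exact: K5.
have lx0 : 0 < s1 - s0 by rewrite subr_gt0.
have ly0 : 0 < 2 * pi :> R by rewrite mulr_gt0 // pi_gt0.
have [| |y yi] := @goursat R (fun s t => Im (H (s +i* t)%C)) (fun s t => Re (H (s +i* t)%C)) s0 (s1 - s0) 0 (2 * pi) lx0 ly0.
- move=> x y /andP[_ xs] _; rewrite subrKC in xs; have [d' /cdiff_frechet2 [K1 K2]] := hdiff (x +i* y)%C xs.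
  by exists (Im d'), (Re d'), (- Im d').
- move=> x _; rewrite /H; have -> : - (x +i* (0 + 2 * pi))%C = ((-x) +i* (- (2 * pi)))%C :> C by rewrite add0r.
  by rewrite -(cexp_period (- x) (- (2 * pi))) addNr cexp_period /GRing.opp /= oppr0.
rewrite subrKC => EE.
have L1 : nc (H (s1 +i* y)%C) <= 2 * M / r.
  rewrite /H ncM ncc mul1r ncM cexpN ncV nc_cexp /= E1 ler_pM2r ?invr_gt0 //.
  have ga : nc (g a) <= M by apply: HM; rewrite subrr nc0 ltW.
  have := HM (a + cexp (s1 +i* y)%C); rewrite addrC addKr nc_cexp /= E1 lexx => /(_ isT) gb.
  apply: le_trans (ncB _ _) _; rewrite addrC; lra.
have L0 : nc (H (s0 +i* y)%C - (nc d)%:C%C) <= eps.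
  set w := cexp (s0 +i* y)%C; have wn : nc w = expR s0 by rewrite nc_cexp.
  have wn0 : w != 0 by exact: cexp_neq0.
  have -> : H (s0 +i* y)%C - (nc d)%:C%C = c * ((g (a + w) - g a - d * w) / w).
    by rewrite -cd /H cexpN -/w; field.
  rewrite ncM ncc mul1r ncM ncV ler_pdivrMr ?nc_gt0 //; apply: Hdel.
  by rewrite wn.
have := le_trans (ler_Re_nc _) L1; have := le_trans (ler_Re_nc _) L0.
rewrite ReB -EE /= !ler_norml => /andP[h1 _] /andP[_ h2].
move: h1 h2; rewrite /eps; lra.
Qed.

End ComplexCalculus.

(** * Entire functions of several variables *)

Section Vectors.
Variables (R : realType) (m : nat).
Local Notation C := R[i].
Local Notation V := 'rV[C]_m.
Local Notation Re := (@complex.Re R).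
Local Notation Im := (@complex.Im R).
Local Notation nc := (@nc R).
Implicit Types (z w v x y : V) (f g : V -> C) (D E : 'cV[C]_m) (F : V -> V).

Definition vnorm v : R := \big[Num.max/0]_(i < m) nc (v 0 i).

Lemma vnorm_ge0 v : 0 <= vnorm v.
Proof. exact: bigmax_ge_id. Qed.
Lemma nc_vnorm v i : nc (v 0 i) <= vnorm v.
Proof. by rewrite /vnorm (bigmaxD1 i) //= le_max lexx. Qed.
Lemma vnorm_le v (M : R) : 0 <= M -> (forall i, nc (v 0 i) <= M) -> vnorm v <= M.
Proof. by move=> M0 H; apply: bigmax_le. Qed.
Lemma vnormD v w : vnorm (v + w) <= vnorm v + vnorm w.
Proof.
apply: vnorm_le => [|i]; first by rewrite addr_ge0 ?vnorm_ge0.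
by rewrite mxE; apply: le_trans (ncD _ _) _; rewrite lerD ?nc_vnorm.
Qed.
Lemma vnormZ c v : vnorm (c *: v) <= nc c * vnorm v.
Proof.
apply: vnorm_le => [|i]; first by rewrite mulr_ge0 ?vnorm_ge0 ?nc_ge0.
by rewrite mxE ncM ler_wpM2l ?nc_ge0 // nc_vnorm.
Qed.
Lemma vnormN v : vnorm (- v) = vnorm v.
Proof. by apply: eq_bigr => i _; rewrite mxE ncN. Qed.
Lemma vnormBC v w : vnorm (v - w) = vnorm (w - v).
Proof. by rewrite -vnormN opprB. Qed.
Lemma vnorm0 : vnorm 0 = 0.
Proof.
by apply/eqP; rewrite eq_le vnorm_ge0 andbT; apply: vnorm_le => // i; rewrite mxE nc0.
Qed.
Lemma vnorm_eq0 v : vnorm v = 0 -> v = 0.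
Proof.
move=> v0; apply/rowP => i; rewrite mxE; apply/eqP; rewrite -nc_eq0 eq_le nc_ge0 andbT -v0.
exact: nc_vnorm.
Qed.
Lemma vnorm_tri x y z : vnorm (x - z) <= vnorm (x - y) + vnorm (y - z).
Proof. by apply: le_trans (vnormD _ _); rewrite addrA subrK. Qed.

Definition dot v D : C := (v *m D) 0 0.
Lemma dotE v D : dot v D = \sum_i v 0 i * D i 0.
Proof. by rewrite /dot mxE. Qed.
Lemma dotDl v w D : dot (v + w) D = dot v D + dot w D.
Proof. by rewrite /dot mulmxDl mxE. Qed.
Lemma dotBl v w D : dot (v - w) D = dot v D - dot w D.
Proof. by rewrite /dot mulmxBl !mxE. Qed.
Lemma dotDr v D E : dot v (D + E) = dot v D + dot v E.
Proof. by rewrite /dot mulmxDr mxE. Qed.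
Lemma dotBr v D E : dot v (D - E) = dot v D - dot v E.
Proof. by rewrite /dot mulmxBr !mxE. Qed.
Lemma dotZl c v D : dot (c *: v) D = c * dot v D.
Proof. by rewrite /dot -scalemxAl mxE. Qed.
Lemma dotZr c v D : dot v (c *: D) = c * dot v D.
Proof. by rewrite /dot -scalemxAr mxE. Qed.
Lemma dot0r v : dot v 0 = 0.
Proof. by rewrite /dot mulmx0 mxE. Qed.
Lemma dot0l D : dot 0 D = 0.
Proof. by rewrite /dot mul0mx mxE. Qed.
Lemma dot_delta i D : dot (delta_mx 0 i) D = D i 0.
Proof. by rewrite /dot -rowE mxE. Qed.
Lemma dot_coord v i : dot v (delta_mx i 0) = v 0 i.
Proof. by rewrite /dot -colE mxE. Qed.

Definition gnorm D : R := \sum_i nc (D i 0).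
Lemma gnorm_ge0 D : 0 <= gnorm D.
Proof. by apply: sumr_ge0 => i _; exact: nc_ge0. Qed.
Lemma nc_dot v D : nc (dot v D) <= gnorm D * vnorm v.
Proof.
rewrite dotE; apply: le_trans (nc_sum _ _ _) _; rewrite mulr_suml; apply: ler_sum => i _.
by rewrite ncM mulrC ler_wpM2l ?nc_ge0 // nc_vnorm.
Qed.

Definition vdiff f z D := forall e, 0 < e -> exists2 r, 0 < r &
  forall w, vnorm w < r -> nc (f (z + w) - f z - dot w D) <= e * vnorm w.

Lemma vdiff_lip f z D : vdiff f z D -> exists2 r, 0 < r &
  forall w, vnorm w < r -> nc (f (z + w) - f z) <= (gnorm D + 1) * vnorm w.
Proof.
move=> /(_ 1 ltr01) [r r0 H]; exists r => // w /H K.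
rewrite -(subrK (dot w D) (_ - _)); apply: le_trans (ncD _ _) _.
by rewrite mulrDl addrC lerD // nc_dot.
Qed.

Lemma vdiff_cst c z : vdiff (fun=> c) z 0.
Proof.
by move=> e e0; exists 1 => // w _; rewrite dot0r !subrr nc0 mulr_ge0 ?vnorm_ge0 // ltW.
Qed.

Lemma vdiff_dot D z : vdiff (dot^~ D) z D.
Proof.
move=> e e0; exists 1 => // w _; have -> : dot (z + w) D - dot z D - dot w D = 0 by rewrite dotDl; ring.
by rewrite nc0 mulr_ge0 ?vnorm_ge0 // ltW.
Qed.

Lemma vdiff_eq f g z D : (forall x, f x = g x) -> vdiff f z D -> vdiff g z D.
Proof. by move=> fg H e /H[r r0 K]; exists r => // w /K; rewrite !fg. Qed.

Lemma vdiff_coord i z : vdiff (fun x => x 0 i) z (delta_mx i 0).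
Proof. by apply: vdiff_eq (vdiff_dot _ z) => x; exact: dot_coord. Qed.

Lemma vdiffD f g z D E : vdiff f z D -> vdiff g z E -> vdiff (fun x => f x + g x) z (D + E).
Proof.
move=> H1 H2 e e0; have e2 : 0 < e / 2 by rewrite divr_gt0.
have [r r0 K1] := H1 _ e2; have [s s0 K2] := H2 _ e2.
exists (Num.min r s) => [|w]; first by rewrite lt_min r0.
rewrite lt_min => /andP[/K1 L1 /K2 L2].
have -> : f (z + w) + g (z + w) - (f z + g z) - dot w (D + E) =
  (f (z + w) - f z - dot w D) + (g (z + w) - g z - dot w E) by rewrite dotDr; ring.
by apply: le_trans (ncD _ _) _; apply: le_trans (lerD L1 L2) _; rewrite -mulrDl -splitr.
Qed.

Lemma cdiff_vdiff_comp f (h : C -> C) z D b : vdiff f z D -> cdiff h (f z) b ->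
  vdiff (h \o f) z (b *: D).
Proof.
move=> H1 H2 e e0.
have n1 : 0 < gnorm D + 1 by have := gnorm_ge0 D; lra.
have n2 : 0 < nc b + 1 by have := nc_ge0 b; lra.
have e1 : 0 < e / 2 / (gnorm D + 1) by rewrite !divr_gt0.
have e2 : 0 < e / 2 / (nc b + 1) by rewrite !divr_gt0.
have [r r0 K1] := H1 _ e2; have [s s0 K2] := H2 _ e1; have [t t0 K3] := vdiff_lip H1.
exists (Num.min (Num.min r t) (s / (gnorm D + 1))) => [|w].
  by rewrite !lt_min r0 t0 divr_gt0.
rewrite !lt_min => /andP[/andP[/K1 L1 /K3 L3] ws].
have L2 := K2 (f (z + w) - f z) _; rewrite subrKC in L2.
have -> : (h \o f) (z + w) - (h \o f) z - dot w (b *: D) =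
  (h (f (z + w)) - h (f z) - b * (f (z + w) - f z)) + b * (f (z + w) - f z - dot w D).
  by rewrite /= dotZr; ring.
apply: le_trans (ncD _ _) _; rewrite ncM.
have {}L2 := L2 _; apply: le_trans (lerD (L2 _) (ler_wpM2l (nc_ge0 b) L1)) _.
  by apply: le_lt_trans L3 _; rewrite mulrC -ltr_pdivlMr.
apply: le_trans (lerD (ler_wpM2l (ltW e1) L3) (lexx _)) _.
have -> : e / 2 / (gnorm D + 1) * ((gnorm D + 1) * vnorm w) = e / 2 * vnorm w by field; apply: lt0r_neq0.
have -> : nc b * (e / 2 / (nc b + 1) * vnorm w) = nc b / (nc b + 1) * (e / 2 * vnorm w) by field; apply: lt0r_neq0.
have w0 : 0 <= e / 2 * vnorm w by rewrite mulr_ge0 ?vnorm_ge0 // ltW // divr_gt0.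
have : nc b / (nc b + 1) <= 1 by rewrite ler_pdivrMr //; lra.
by move=> /(ler_wpM2r w0); lra.
Qed.

Lemma cdiff_line f x v t D : vdiff f (x + t *: v) D ->
  cdiff (fun t => f (x + t *: v)) t (dot v D).
Proof.
move=> H e e0; have n1 : 0 < vnorm v + 1 by have := vnorm_ge0 v; lra.
have [|r r0 K] := H (e / (vnorm v + 1)); first by rewrite divr_gt0.
exists (r / (vnorm v + 1)) => [|w]; first by rewrite divr_gt0.
rewrite ltr_pdivlMr // => wr; have wv := vnormZ w v.
have wn := nc_ge0 w; have := K (w *: v).
have -> : x + t *: v + w *: v = x + (t + w) *: v by rewrite scalerDl addrA.
rewrite dotZl mulrC => /(_ _) /le_trans; apply; first by apply: le_lt_trans wr; lra.
rewrite mulrAC ler_pdivrMr // -mulrA ler_pM2l //; lra.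
Qed.

Lemma vdiffZ c f z D : vdiff f z D -> vdiff (fun x => c * f x) z (c *: D).
Proof.
move=> H; have K : cdiff (fun y : C => c * y) (f z) c.
  by have := cdiffMl c (cdiff_id (f z)); rewrite mulr1.
exact: (cdiff_vdiff_comp H K).
Qed.

(* Polarization: [4 f g = (f + g)^2 - (f - g)^2]. *)
Lemma vdiffM f g z D E : vdiff f z D -> vdiff g z E ->
  vdiff (fun x => f x * g x) z (g z *: D + f z *: E).
Proof.
have sq h G : vdiff h z G -> vdiff (fun x => h x * h x) z ((2 * h z) *: G).
  move=> H; have K : cdiff (fun y : C => y * y) (h z) (2 * h z).
    have -> : 2 * h z = 1 * h z + h z * 1 by ring.
    exact: cdiffM (cdiff_id _) (cdiff_id _).
  exact: (cdiff_vdiff_comp H K).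
move=> Hf Hg; have S1 := sq _ _ (vdiffD Hf Hg).
have S2 := sq _ _ (vdiffD Hf (vdiffZ (-1) Hg)).
have := vdiffZ 4^-1 (vdiffD S1 (vdiffZ (-1) S2)).
set G := _ *: (_ + _); have -> : G = g z *: D + f z *: E.
  by apply/matrixP => i j; rewrite /G !mxE; field.
by apply: vdiff_eq => x; field.
Qed.

Definition entire f := forall z, exists D, vdiff f z D.

Lemma entire_eq f g : (forall x, f x = g x) -> entire f -> entire g.
Proof. by move=> fg H z; have [D K] := H z; exists D; exact: vdiff_eq fg K. Qed.
Lemma entire_cst c : entire (fun=> c).
Proof. by move=> z; exists 0; exact: vdiff_cst. Qed.
Lemma entire_coord i : entire (fun x => x 0 i).
Proof. by move=> z; exists (delta_mx i 0); exact: vdiff_coord. Qed.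
Lemma entireD f g : entire f -> entire g -> entire (fun x => f x + g x).
Proof. by move=> H1 H2 z; have [D ?] := H1 z; have [E ?] := H2 z; exists (D + E); exact: vdiffD. Qed.
Lemma entireM f g : entire f -> entire g -> entire (fun x => f x * g x).
Proof.
by move=> H1 H2 z; have [D h1] := H1 z; have [E h2] := H2 z; exists (g z *: D + f z *: E); exact: vdiffM h1 h2.
Qed.
Lemma entireN f : entire f -> entire (fun x => - f x).
Proof.
move=> H; apply: (@entire_eq (fun x => -1 * f x)) => [x|]; first by rewrite mulN1r.
exact: entireM (entire_cst _) H.
Qed.
Lemma entireB f g : entire f -> entire g -> entire (fun x => f x - g x).
Proof. by move=> H1 H2; apply: entireD H1 (entireN H2). Qed.
Lemma entireX f n : entire f -> entire (fun x => f x ^+ n).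
Proof.
move=> H; elim: n => [|n IH]; first exact: entire_cst.
by apply: entire_eq (entireM H IH) => x; rewrite exprS.
Qed.
Lemma entire_prod I (s : seq I) (P : pred I) (f : I -> V -> C) :
  (forall i, entire (f i)) -> entire (fun x => \prod_(i <- s | P i) f i x).
Proof.
move=> H; elim: s => [|i s IH]; first by apply: entire_eq (entire_cst 1) => x; rewrite big_nil.
case: (boolP (P i)) => Pi; last by apply: entire_eq IH => x; rewrite big_cons (negbTE Pi).
by apply: entire_eq (entireM (H i) IH) => x; rewrite big_cons Pi.
Qed.
Lemma entire_cexp f : entire f -> entire (fun x => cexp (f x)).
Proof.
by move=> H z; have [D h] := H z; exists (cexp (f z) *: D); exact: (cdiff_vdiff_comp h (cdiff_cexp _)).
Qed.

Definition entire_map F := forall i, entire (fun x => F x 0 i).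

(** Vectors are rows: the differential is [w *m J], the columns of [J] are the gradients of the
    coordinates, and in the chain rule the inner matrix stands on the left. *)
Definition jacobian F z (J : 'M[C]_m) := forall i, vdiff (fun x => F x 0 i) z (col i J).

Lemma jacobian_exists F z : entire_map F -> exists J, jacobian F z J.
Proof.
move=> H; have [D HD] := choice (fun i => H i z).
exists (\matrix_(i, j) D j i 0) => i; have -> : col i (\matrix_(i, j) D j i 0) = D i.
  by apply/colP => k; rewrite !mxE.
exact: HD.
Qed.

Lemma vec_dotE (w : V) (J : 'M[C]_m) i : (w *m J) 0 i = dot w (col i J).
Proof. by rewrite /dot colE mulmxA -colE [in RHS]mxE. Qed.

Lemma dot_mulmx (w : V) (J : 'M[C]_m) D : dot (w *m J) D = dot w (J *m D).
Proof. by rewrite /dot mulmxA. Qed.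

Lemma jacobian_lip F z J : jacobian F z J -> exists B r, [/\ 0 < B, 0 < r &
  forall w, vnorm w < r -> vnorm (F (z + w) - F z) <= B * vnorm w].
Proof.
move=> H; have ch i : exists Br : R * R, 0 < Br.1 /\ 0 < Br.2 /\ forall w, vnorm w < Br.2 ->
    nc ((F (z + w) - F z) 0 i) <= Br.1 * vnorm w.
  have [r r0 K] := vdiff_lip (H i); exists (gnorm (col i J) + 1, r) => /=.
  split; first by have := gnorm_ge0 (col i J); lra.
  by split => // w /K; rewrite !mxE.
have [br Hbr] := choice ch.
exists (1 + \sum_i (br i).1), (\big[Num.min/1]_i (br i).2).
have S0 : 0 <= \sum_i (br i).1 by apply: sumr_ge0 => i _; exact: ltW (Hbr i).1.
split; first lra.
  by apply: lt_bigmin => // i _; exact: (Hbr i).2.1.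
move=> w wr; apply: vnorm_le => [|i]; first by rewrite mulr_ge0 ?vnorm_ge0 //; lra.
have [b0 [_ K]] := Hbr i; apply: le_trans (K w _) _.
  by apply: lt_le_trans wr _; exact: bigmin_le_cond.
rewrite ler_wpM2r ?vnorm_ge0 // (bigD1 i) //=.
have : 0 <= \sum_(j < m | j != i) (br j).1 by apply: sumr_ge0 => j _; exact: ltW (Hbr j).1.
lra.
Qed.

Lemma vdiff_comp f F z J D : jacobian F z J -> vdiff f (F z) D -> vdiff (f \o F) z (J *m D).
Proof.
move=> HF Hf e e0; have [B [r [B0 r0 KB]]] := jacobian_lip HF.
have G1 : 0 < gnorm D + 1 by have := gnorm_ge0 D; lra.
have [|s s0 Ks] := Hf (e / 2 / B); first by rewrite !divr_gt0.
have e1 : 0 < e / 2 / (gnorm D + 1) by rewrite !divr_gt0.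
have [t t0 Kt] : exists2 t, 0 < t & forall w, vnorm w < t ->
    vnorm (F (z + w) - F z - w *m J) <= e / 2 / (gnorm D + 1) * vnorm w.
  have [q Hq] := choice (fun i => let: ex_intro2 q a b := HF i _ e1 in ex_intro (fun q => 0 < q /\ forall w, vnorm w < q ->
    nc (F (z + w) 0 i - F z 0 i - dot w (col i J)) <= e / 2 / (gnorm D + 1) * vnorm w) q (conj a b)).
  exists (\big[Num.min/1]_i q i); first by apply: lt_bigmin => // i _; exact: (Hq i).1.
  move=> w wq; apply: vnorm_le => [|i]; first by rewrite mulr_ge0 ?vnorm_ge0 // ltW.
  have -> : (F (z + w) - F z - w *m J) 0 i = F (z + w) 0 i - F z 0 i - dot w (col i J).
    by rewrite -vec_dotE !mxE.
  apply: (Hq i).2.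
  by apply: lt_le_trans wq _; exact: bigmin_le_cond.
exists (Num.min (Num.min r (s / B)) t) => [|w].
  by rewrite !lt_min r0 t0 divr_gt0.
rewrite !lt_min => /andP[/andP[/KB L1 wB] /Kt L2].
have L3 := Ks (F (z + w) - F z) _; rewrite subrKC in L3.
have -> : (f \o F) (z + w) - (f \o F) z - dot w (J *m D) =
   (f (F (z + w)) - f (F z) - dot (F (z + w) - F z) D) + dot (F (z + w) - F z - w *m J) D.
  by rewrite /= -dot_mulmx (dotBl (F (z + w) - F z)); ring.
apply: le_trans (ncD _ _) _; have {}L3 := L3 _.
apply: le_trans (lerD (L3 _) (nc_dot _ _)) _.
  by apply: le_lt_trans L1 _; rewrite mulrC -ltr_pdivlMr.
apply: le_trans (lerD (ler_wpM2l _ L1) (ler_wpM2l (gnorm_ge0 _) L2)) _.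
  by rewrite ltW // !divr_gt0.
have -> : e / 2 / B * (B * vnorm w) = e / 2 * vnorm w by field; apply: lt0r_neq0.
have -> : gnorm D * (e / 2 / (gnorm D + 1) * vnorm w) = gnorm D / (gnorm D + 1) * (e / 2 * vnorm w) by field; apply: lt0r_neq0.
have w0 : 0 <= e / 2 * vnorm w by rewrite mulr_ge0 ?vnorm_ge0 // ltW // divr_gt0.
have : gnorm D / (gnorm D + 1) <= 1 by rewrite ler_pdivrMr //; lra.
by move=> /(ler_wpM2r w0); lra.
Qed.

Lemma entire_comp f F : entire f -> entire_map F -> entire (f \o F).
Proof.
move=> Hf HF z; have [J HJ] := jacobian_exists z HF; have [D HD] := Hf (F z).
by exists (J *m D); exact: vdiff_comp.
Qed.

Lemma jacobian_comp F G z J K : jacobian F z J -> jacobian G (F z) K -> jacobian (G \o F) z (J *m K).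
Proof. by move=> HF HG i; rewrite colE -mulmxA -colE; exact: vdiff_comp HF (HG i). Qed.

(** Cauchy's inequality on the complex line through a in direction v, for the disc of radius r /
    |v|. *)
Lemma entire_cauchy f a D (r M : R) : entire f -> 0 < r ->
  (forall z, vnorm (z - a) <= r -> nc (f z) <= M) -> vdiff f a D ->
  forall v, nc (dot v D) <= 2 * M / r * vnorm v.
Proof.
move=> Hf r0 HM HD v; have [v0|v0] := eqVneq (vnorm v) 0.
  by rewrite (vnorm_eq0 v0) dot0l nc0 vnorm0 mulr0.
have vp : 0 < vnorm v by rewrite lt_def v0 vnorm_ge0.
have := @cauchy_inequality R (fun t => f (a + t *: v)) 0 (dot v D) (r / vnorm v) M.
have -> : 2 * M / (r / vnorm v) = 2 * M / r * vnorm v by field; rewrite v0 lt0r_neq0.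
apply; first by rewrite divr_gt0.
- by move=> t _; have [E HE] := Hf (a + t *: v); exists (dot v E); exact: cdiff_line.
- move=> t; rewrite subr0 ler_pdivlMr // => tr; apply: HM; rewrite addrC addKr.
  exact: le_trans (vnormZ _ _) tr.
- by apply: cdiff_line; rewrite scale0r addr0.
Qed.

(** After a rotation that makes f x - f y real and positive, the real mean value theorem applies to
    the real part along the segment. *)
Lemma mean_value f x y (K : R) : entire f ->
  (forall (t : R) D, 0 <= t <= 1 -> vdiff f (y + t%:C%C *: (x - y)) D -> nc (dot (x - y) D) <= K) ->
  nc (f x - f y) <= K.
Proof.
move=> Hf HK; set d := f x - f y.
have [->|d0] := eqVneq d 0.
  have [D HD] := Hf y; rewrite nc0; apply: le_trans (nc_ge0 _) (HK 0 D _ _); first by rewrite lexx ler01.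
  by rewrite scale0r addr0.
have ncd : nc d != 0 by rewrite nc_eq0.
pose c := (nc d)%:C%C / d.
have ncc : nc c = 1 by rewrite ncM ncV ncR ger0_norm ?nc_ge0 // divff.
have [D HD] := choice (fun t : R => Hf (y + t%:C%C *: (x - y))).
pose u t := Re (c * f (y + t%:C%C *: (x - y))).
have du t : rdiff u t (Re (c * dot (x - y) (D t))).
  have /cdiff_frechet2 [K1 _] := cdiffMl c (cdiff_line (HD t)).
  move=> e e0; have [r r0 Hr] := K1 e e0; exists r => // h hr.
  have := Hr h 0 hr; rewrite normr0 mulr0 subr0 !addr0; exact.
have [t ti] := rdiff_mvt ler01 (fun t _ => du t).
rewrite subr0 mulr1 /u !scale1r scale0r addr0 subrKC -ReB -mulrBr -/d /c mulfVK //= => E.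
apply: le_trans (HK t _ ti (HD t)); apply: le_trans (ler_norm _) _.
by rewrite E; apply: le_trans (ler_Re_nc _) _; rewrite ncM ncc mul1r.
Qed.

Lemma vnorm_segment a x y (s t : R) : 0 <= t <= 1 -> vnorm (x - a) <= s -> vnorm (y - a) <= s ->
  vnorm (y + t%:C%C *: (x - y) - a) <= s.
Proof.
move=> /andP[t0 t1] xs ys.
have -> : y + t%:C%C *: (x - y) - a = t%:C%C *: (x - a) + (1 - t)%:C%C *: (y - a).
  by apply/rowP => i; rewrite !mxE rmorphB; ring.
apply: le_trans (vnormD _ _) _; apply: le_trans (lerD (vnormZ _ _) (vnormZ _ _)) _.
rewrite !ncR !ger0_norm ?subr_ge0 //.
have t1' : 0 <= 1 - t by rewrite subr_ge0.
have := ler_wpM2l t0 xs; have := ler_wpM2l t1' ys; lra.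
Qed.

Lemma entire_lipschitz f a x y (s r M : R) : entire f -> 0 < r ->
  (forall z, vnorm (z - a) <= s + r -> nc (f z) <= M) ->
  vnorm (x - a) <= s -> vnorm (y - a) <= s ->
  nc (f x - f y) <= 2 * M / r * vnorm (x - y).
Proof.
move=> Hf r0 HM xs ys; apply: mean_value => // t D ti HD.
apply: (entire_cauchy Hf r0 _ HD) => z zr; apply: HM.
by apply: le_trans (vnorm_tri _ _ _) _; rewrite (addrC s); apply: lerD zr _; exact: vnorm_segment.
Qed.

Lemma vdiff_translate f h z D : vdiff f (z + h) D -> vdiff (fun x => f (x + h)) z D.
Proof. by move=> H e /H[r r0 K]; exists r => // w wr; rewrite (addrAC z w h); exact: K. Qed.

Lemma entire_translate f h : entire f -> entire (fun x => f (x + h)).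
Proof. by move=> H z; have [D ?] := H (z + h); exists D; exact: vdiff_translate. Qed.

Lemma vdiffB f g z D E : vdiff f z D -> vdiff g z E -> vdiff (fun x => f x - g x) z (D - E).
Proof.
move=> Hf /(vdiffZ (-1)) Hg; have := vdiffD Hf Hg; rewrite scaleN1r.
by apply: vdiff_eq => x; rewrite mulN1r.
Qed.

(* Cauchy's inequality for the entire function [f (z + h) - f z]. *)
Lemma entire_diff_lipschitz f a h (r M : R) D E : entire f -> 0 < r ->
  (forall z, vnorm (z - a) <= 3 * r -> nc (f z) <= M) -> vnorm h <= r ->
  vdiff f a D -> vdiff f (a + h) E ->
  forall v, nc (dot v (E - D)) <= 4 * M / r ^+ 2 * vnorm h * vnorm v.
Proof.
move=> Hf r0 HM hr HD HE v.
have -> : 4 * M / r ^+ 2 * vnorm h = 2 * (2 * M / r * vnorm h) / r by field; rewrite lt0r_neq0.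
apply: (entire_cauchy (f := fun z => f (z + h) - f z) (a := a)) => //.
- exact: entireB (entire_translate _ Hf) Hf.
- move=> z zr; have -> : vnorm h = vnorm (z + h - z) by rewrite (addrC z) addrK.
  apply: (@entire_lipschitz _ a _ _ (2 * r)) => //.
  + by move=> x xr; apply: HM; apply: le_trans xr _; lra.
  + by rewrite addrAC; apply: le_trans (vnormD _ _) _; lra.
  + lra.
- exact: vdiffB (vdiff_translate HE) HD.
Qed.

(** Subtracting the linear part leaves a function whose gradient within distance s of a is at most 4
    M s / r^2 by [entire_diff_lipschitz]; the mean value theorem finishes. *)
Lemma entire_taylor f a D (r s M : R) x y : entire f -> 0 < r -> s <= r ->
  (forall z, vnorm (z - a) <= 3 * r -> nc (f z) <= M) -> vdiff f a D ->
  vnorm (x - a) <= s -> vnorm (y - a) <= s ->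
  nc (f x - f y - dot (x - y) D) <= 4 * M / r ^+ 2 * s * vnorm (x - y).
Proof.
move=> Hf r0 sr HM HD xs ys.
have M0 : 0 <= M by apply: le_trans (nc_ge0 (f a)) (HM a _); rewrite subrr vnorm0; lra.
have -> : f x - f y - dot (x - y) D = (f x - dot x D) - (f y - dot y D) by rewrite dotBl; ring.
have He : entire (fun z => f z - dot z D).
  by move=> z; have [E HE] := Hf z; exists (E - D); exact: vdiffB HE (vdiff_dot D z).
apply: mean_value He _ => t G ti HG.
have := vnorm_segment ti xs ys; set p := y + _ => ps.
have HE : vdiff f p (G + D) by apply: vdiff_eq (vdiffD HG (vdiff_dot D p)) => z; rewrite subrK.
rewrite -[G](addrK D); have := @entire_diff_lipschitz f a (p - a) r M D (G + D) Hf r0 HM.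
rewrite subrKC => /(_ (le_trans ps sr) HD HE (x - y)) /le_trans; apply.
by rewrite ler_wpM2r ?vnorm_ge0 // ler_wpM2l // divr_ge0 ?sqr_ge0 // mulr_ge0.
Qed.

End Vectors.

(** * Borel-Caratheodory, a quantitative inverse function theorem, boundedness on balls *)

Section QuantitativeEstimates.
Variable R : realType.
Local Notation C := R[i].
Local Notation Re := (@complex.Re R).
Local Notation Im := (@complex.Im R).
Local Notation nc := (@nc R).

Lemma rdiffM (f g : R -> R) x a b : rdiff f x a -> rdiff g x b ->
  rdiff (fun y => f y * g y) x (f x * b + g x * a).
Proof.
by move=> /rdiffP H1 /rdiffP H2; apply/rdiffP; exact: is_deriveM.
Qed.

Lemma rdiffD (f g : R -> R) x a b : rdiff f x a -> rdiff g x b ->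
  rdiff (fun y => f y + g y) x (a + b).
Proof.
by move=> /rdiffP H1 /rdiffP H2; apply/rdiffP; exact: is_deriveD.
Qed.

Lemma rdiff_cst (c x : R) : rdiff (fun=> c) x 0.
Proof. by apply/rdiffP; exact: is_derive_cst. Qed.

Lemma rdiff_expRM (k x : R) : rdiff (fun y => expR (k * y)) x (expR (k * x) * k).
Proof.
apply/rdiffP; apply: (@is_derive1_comp R expR (fun y => k * y)).
apply/rdiffP => e e0; exists 1 => // h _; have -> : k * (x + h) - k * x - k * h = 0 by ring.
by rewrite normr0 mulr_ge0 // ltW.
Qed.

(** Let c be the mirror image of g a in the line Re = L. Then |c - g| >= A = L - Re (g a) on the
    disc, and c - g a = 2 A, so Cauchy's inequality for 1 / (c - g) reads |d| / (4 A^2) <= 2 / (A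
    r). *)
Lemma borel_caratheodory_deriv (g : C -> C) (a d : C) (r L : R) : 0 < r ->
  (forall z, nc (z - a) <= r -> exists d', cdiff g z d') ->
  (forall z, nc (z - a) <= r -> Re (g z) < L) ->
  cdiff g a d -> nc d <= 8 * (L - Re (g a)) / r.
Proof.
move=> r0 Hd HL Hda; pose A := L - Re (g a).
have A0 : 0 < A by rewrite subr_gt0; apply: HL; rewrite subrr nc0 ltW.
pose c : C := Complex (L + A) (Im (g a)).
have low z : nc (z - a) <= r -> A <= nc (c - g z).
  move=> /HL h; apply: le_trans (le_trans (ler_norm _) (ler_Re_nc _)).
  rewrite ReB /c /=; lra.
have inv z d' : nc (z - a) <= r -> cdiff g z d' ->
    cdiff (fun x => (c - g x)^-1) z (((c - g z)^-1 * (c - g z)^-1) * d').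
  move=> zr K; have n0 : c - g z != 0 by rewrite -nc_gt0; exact: lt_le_trans A0 (low z zr).
  have K1 := cdiffD (cdiff_cst c z) (cdiffN K).
  have K2 : cdiff (fun y : C => y^-1) (c + - g z) (- ((c - g z)^-1 * (c - g z)^-1)) by exact: cdiffV.
  have := cdiff_comp K1 K2; rewrite add0r mulrNN; exact: cdiff_eq.
have ra : nc (a - a) <= r by rewrite subrr nc0 ltW.
have cga : c - g a = (2 * A)%:C%C.
  by rewrite /c /A; case: (g a) => p q; apply/eqP; rewrite eq_complex /=; apply/andP; split; apply/eqP; ring.
have := @cauchy_inequality R (fun x => (c - g x)^-1) a _ r A^-1 r0 _ _ (inv a d ra Hda).
rewrite cga !ncM !ncV ncR ger0_norm; last by lra.
move=> H; have {}H := H _ _.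
have : (2 * A)^-1 * (2 * A)^-1 * nc d <= 2 * A^-1 / r.
  apply: H => z zr; first by have [d' K] := Hd z zr; eexists; exact: inv zr K.
  by rewrite ncV lef_pV2 ?posrE // ?(lt_le_trans A0 (low z zr)) // low.
have -> : (2 * A)^-1 * (2 * A)^-1 * nc d = nc d / (4 * A ^+ 2) by field; apply: lt0r_neq0.
rewrite ler_pdivrMr; last by rewrite mulr_gt0 // exprn_gt0.
have -> : 2 / A / r * (4 * A ^+ 2) = 8 * A / r by field; rewrite !lt0r_neq0.
by [].
Qed.

(* Gronwall for [|L - g|^2] along the segment from 0 to 1. *)
Lemma borel_caratheodory (g : C -> C) (eta L : R) : 0 < eta ->
  (forall z, exists d, cdiff g z d) -> g 0 = 0 ->
  (forall (t : R) z, 0 <= t <= 1 -> nc (z - t%:C%C) <= eta -> Re (g z) < L) ->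
  nc (g 1) <= 2 * L * expR (16 / eta).
Proof.
move=> eta0 Hd g0 HL.
have L0 : 0 < L.
  by have := HL 0 0; rewrite g0 subrr nc0; apply; [rewrite lexx ler01|exact: ltW].
have [D HD] := choice (fun t : R => Hd t%:C%C).
pose u t := Re (g t%:C%C); pose v t := Im (g t%:C%C).
have du t : rdiff u t (Re (D t)).
  have /cdiff_frechet2 [K _] : cdiff g (t +i* 0)%C (D t) by exact: HD.
  move=> e e0; have [r r0 Hr] := K e e0; exists r => // h hr.
  have := Hr h 0 hr; rewrite normr0 mulr0 subr0 !addr0; exact.
have dv t : rdiff v t (Im (D t)).
  have /cdiff_frechet2 [_ K] : cdiff g (t +i* 0)%C (D t) by exact: HD.
  move=> e e0; have [r r0 Hr] := K e e0; exists r => // h hr.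
  have := Hr h 0 hr; rewrite normr0 mulr0 subr0 !addr0; exact.
(* The previous lemma bounds |g'| by 8 w / eta, so the derivative of w^2 + v^2 is at most (32 / eta)
   (w^2 + v^2), and multiplication by exp (- K t) makes it nonincreasing. The final square root
   halves the rate to 16 / eta. *)
pose K := 32 / eta.
pose w t := L - u t.
have dw t : rdiff w t (0 - Re (D t)) by exact: rdiffB (rdiff_cst _ _) (du t).
have dpsi t := rdiffM (rdiffD (rdiffM (dw t) (dw t)) (rdiffM (dv t) (dv t))) (rdiff_expRM (- K) t).
have [c ci] := rdiff_mvt ler01 (fun t _ => dpsi t).
have wc0 : 0 < w c.
  by rewrite subr_gt0; apply: (HL c) => //; rewrite subrr nc0 ltW.
have ncD : nc (D c) <= 8 * w c / eta.
  by apply: borel_caratheodory_deriv (HD c) => // z; exact: HL.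
have hr := le_trans (ler_Re_nc _) ncD; have hi := le_trans (ler_Im_nc _) ncD.
have e0 := expR_gt0 (- K * c).
set X := (X in _ = X * _); have X0 : X <= 0.
  rewrite /X; set E := expR _ in e0 *; set p := Re _ in hr *; set q := Im _ in hi *.
  set W := w c in wc0 hr hi *; set Y := v c.
  have -> : (W * W + Y * Y) * (E * - K) + E * (W * (0 - p) + W * (0 - p) + (Y * q + Y * q)) =
     E * (2 * (Y * q - W * p) - K * (W * W + Y * Y)) by ring.
  apply: mulr_ge0_le0; first exact: ltW.
  have KE : K * (W * W + Y * Y) = 32 * (W * W / eta + Y * Y / eta) by rewrite /K; field; apply: lt0r_neq0.
  have h1 : - (W * p) <= 8 * (W * W / eta).
    have : W * (- p) <= W * (8 * W / eta) by rewrite ler_pM2l //; apply: le_trans hr; rewrite -normrN ler_norm.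
    rewrite mulrN => /le_trans; apply; rewrite le_eqVlt; apply/orP; left; apply/eqP; field; exact: lt0r_neq0.
  have h2 : Y * q <= 4 * (W * W / eta + Y * Y / eta).
    apply: le_trans (ler_norm _) _; rewrite normrM.
    apply: le_trans (ler_wpM2l (normr_ge0 _) hi) _.
    have -> : `|Y| * (8 * W / eta) = 8 * `|Y| * W / eta by field; apply: lt0r_neq0.
    have -> : 4 * (W * W / eta + Y * Y / eta) = 4 * (W * W + Y * Y) / eta by field; apply: lt0r_neq0.
    rewrite ler_pM2r ?invr_gt0 //; have := sqr_ge0 (`|Y| - W).
    have -> : Y * Y = `|Y| * `|Y| by rewrite -normrM ger0_norm // -expr2 sqr_ge0.
    rewrite expr2; lra.
  have h3 : 0 <= W * W / eta by rewrite divr_ge0 ?mulr_ge0 // ltW.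
  have h4 : 0 <= Y * Y / eta by rewrite divr_ge0 ?(ltW eta0) // -expr2 sqr_ge0.
  rewrite KE; lra.
rewrite /= subr0 mulr1 mulr1 mulr0 expR0 mulr1 => EE.
have : (w 1 * w 1 + v 1 * v 1) * expR (- K) <= w 0 * w 0 + v 0 * v 0 by lra.
have -> : w 0 * w 0 + v 0 * v 0 = L ^+ 2.
  by rewrite /w /u /v g0 /= subr0 mulr0 addr0 expr2.
rewrite expRN ler_pdivrMr ?expR_gt0 // => H.
have Kh : expR K = expR (16 / eta) ^+ 2.
  by rewrite expr2 -expRD /K; congr expR; field; apply: lt0r_neq0.
have E : nc (L%:C%C - g 1) ^+ 2 = w 1 * w 1 + v 1 * v 1.
  rewrite /w /u /v; case: (g 1%:C%C) => p q /=.
  rewrite /nc /= sqr_sqrtr ?addr_ge0 ?sqr_ge0 // sub0r sqrrN !expr2 //.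
have H1 : nc (L%:C%C - g 1) <= L * expR (16 / eta).
  rewrite -(@ler_pXn2r _ 2) // ?nnegrE ?nc_ge0 ?mulr_ge0 ?expR_ge0 ?(ltW L0) //.
  by rewrite E exprMn -Kh.
have H2 : nc (g 1) <= L + nc (L%:C%C - g 1).
  have {1}-> : g 1 = L%:C%C - (L%:C%C - g 1) by ring.
  by apply: le_trans (ncB _ _) _; rewrite ncR (ger0_norm (ltW L0)).
have : 1 <= expR (16 / eta) by rewrite -expR0 ler_expR divr_ge0 // ltW.
move=> /(ler_wpM2l (ltW L0)); lra.
Qed.

Lemma det_bound k (A : 'M[C]_k) (B : R) : (forall i j, nc (A i j) <= B) ->
  nc (\det A) <= k`!%:R * B ^+ k.
Proof.
move=> H; rewrite /determinant; apply: le_trans (nc_sum _ _ _) _.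
have -> : k`!%:R * B ^+ k = \sum_(s : {perm 'I_k}) B ^+ k.
  by rewrite sumr_const card_Sn mulr_natl.
apply: ler_sum => s _; rewrite ncM ncX ncN nc1 expr1n mul1r nc_prod.
rewrite -[in X in _ <= _ ^+ X](card_ord k) -prodr_const; apply: ler_prod => i _.
by rewrite nc_ge0 H.
Qed.

(** Cramer's rule: the entries of the inverse are cofactors divided by the determinant. *)
Lemma invmx_bound m (J : 'M[C]_m) (B : R) : 0 <= B -> (forall i j, nc (J i j) <= B) -> \det J != 0 ->
  forall w : 'rV[C]_m, vnorm (w *m invmx J) <= m%:R * (m.-1`!%:R * B ^+ m.-1) / nc (\det J) * vnorm w.
Proof.
move=> B0 HB d0 w; have dn : 0 < nc (\det J) by rewrite nc_gt0.
apply: vnorm_le => [|i].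
  by rewrite mulr_ge0 ?vnorm_ge0 // divr_ge0 ?nc_ge0 // !mulr_ge0 ?exprn_ge0.
rewrite /invmx unitmxE unitfE d0 mxE; apply: le_trans (nc_sum _ _ _) _.
have -> : m%:R * (m.-1`!%:R * B ^+ m.-1) / nc (\det J) * vnorm w =
    \sum_(j < m) vnorm w * ((nc (\det J))^-1 * (m.-1`!%:R * B ^+ m.-1)).
  by rewrite sumr_const card_ord -[RHS]mulr_natl; field; apply: lt0r_neq0.
apply: ler_sum => j _; rewrite ncM !mxE ncM ncV; apply: ler_pM (nc_vnorm _ _) _.
- exact: nc_ge0.
- by rewrite mulr_ge0 ?nc_ge0 ?invr_ge0 ?nc_ge0.
rewrite ler_pM2l ?invr_gt0 // /cofactor ncM ncX ncN nc1 expr1n mul1r.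
by apply: det_bound => p q; rewrite !mxE.
Qed.

Lemma real_geometric_cauchy (a : nat -> R) s : (forall n, `|a n.+1 - a n| <= s * 2^-1 ^+ n.+1) ->
  exists l, forall n, `|l - a n| <= s * 2^-1 ^+ n.
Proof.
move=> H; have s0 : 0 <= s.
  have := le_trans (normr_ge0 _) (H 0%N); rewrite expr1; lra.
have half n : s * 2^-1 ^+ n = 2 * (s * 2^-1 ^+ n.+1) by rewrite exprS; field.
have [|||u Hu] := @nested_point R (fun n => a n - s * 2^-1 ^+ n) (2 * s).
- by move=> n; have := H n; rewrite ler_norml (half n); lra.
- by move=> n; have := H n; rewrite ler_norml -!mulrA (half n); lra.
- lra.
- exists u => n; have := Hu n; rewrite ler_norml -mulrA; lra.
Qed.

Lemma complex_geometric_cauchy (a : nat -> C) s : (forall n, nc (a n.+1 - a n) <= s * 2^-1 ^+ n.+1) ->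
  exists l, forall n, nc (l - a n) <= 2 * s * 2^-1 ^+ n.
Proof.
move=> H.
have [p Hp] := @real_geometric_cauchy (fun n => Re (a n)) s
  (fun n => le_trans (eq_ind _ (fun x => `|x| <= _) (ler_Re_nc _) _ (ReB _ _)) (H n)).
have [q Hq] := @real_geometric_cauchy (fun n => Im (a n)) s
  (fun n => le_trans (eq_ind _ (fun x => `|x| <= _) (ler_Im_nc _) _ (ImB _ _)) (H n)).
exists (p +i* q)%C => n; apply: le_trans (nc_le_ReIm _) _; rewrite ReB ImB /=.
have := Hp n; have := Hq n; lra.
Qed.

Section Several.
Variable m : nat.
Local Notation V := 'rV[C]_m.

Lemma vector_geometric_cauchy (a : nat -> V) s : (forall n, vnorm (a n.+1 - a n) <= s * 2^-1 ^+ n.+1) ->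
  exists l, forall n, vnorm (l - a n) <= 2 * s * 2^-1 ^+ n.
Proof.
move=> H; have s0 : 0 <= s.
  have := le_trans (vnorm_ge0 _) (H 0%N); rewrite expr1; lra.
have ch i : exists l, forall n, nc (l - a n 0 i) <= 2 * s * 2^-1 ^+ n.
  apply: complex_geometric_cauchy => n; apply: le_trans (H n).
  by have := nc_vnorm (a n.+1 - a n) i; rewrite !mxE.
have [l Hl] := choice ch; exists (\row_i l i) => n; apply: vnorm_le => [|i].
  by rewrite !mulr_ge0 // exprn_ge0 // invr_ge0.
by rewrite !mxE.
Qed.

Lemma jacobian_bound (F : V -> V) a J (r M : R) : entire_map F -> 0 < r ->
  (forall z, vnorm (z - a) <= r -> vnorm (F z) <= M) -> jacobian F a J ->
  forall i j, nc (J i j) <= 2 * M / r.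
Proof.
move=> HF r0 HM HJ i j.
have M0 : 0 <= M by apply: le_trans (vnorm_ge0 (F a)) (HM a _); rewrite subrr vnorm0 ltW.
have := @entire_cauchy R m _ a _ r M (HF j) r0 (fun z zr => le_trans (nc_vnorm _ _) (HM z zr)) (HJ j) (delta_mx 0 i).
rewrite dot_delta mxE => /le_trans; apply; apply: ler_piMr.
  by rewrite divr_ge0 ?mulr_ge0 // ltW.
apply: vnorm_le => // k; rewrite mxE; case: (_ && _); by rewrite ?nc1 ?nc0.
Qed.

(** Banach iteration from a. Since the first step is at most s / 4, all iterates stay within s / 2
    of a, so contraction on the ball of radius s suffices. *)
Lemma contraction_solve (G : V -> V) a (s : R) : 0 < s ->
  (forall x y, vnorm (x - a) <= s -> vnorm (y - a) <= s -> vnorm (G x - G y) <= 2^-1 * vnorm (x - y)) ->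
  vnorm (G a - a) <= s / 4 -> exists z, vnorm (z - a) <= s /\ G z = z.
Proof.
move=> s0 HG Ha; pose z n := iter n G a.
have st n : vnorm (z n - a) <= s * (1 - 2^-1 ^+ n) / 2 /\ vnorm (z n.+1 - z n) <= s / 2 * 2^-1 ^+ n.+1.
  elim: n => [|n [IH1 IH2]].
    by rewrite /z /= subrr vnorm0 expr0 expr1; split; lra.
  have p0 : 0 < s * 2^-1 ^+ n.+1 by rewrite mulr_gt0 // exprn_gt0 // invr_gt0.
  have hs : s * 2^-1 ^+ n = 2 * (s * 2^-1 ^+ n.+1) by rewrite exprS; field.
  have A1 : vnorm (z n.+1 - a) <= s * (1 - 2^-1 ^+ n.+1) / 2.
    apply: le_trans (vnorm_tri _ (z n) _) _; move: IH1 IH2 hs; lra.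
  split => //; have := HG (z n.+1) (z n); rewrite -/(z n.+2) => /(_ _ _)/le_trans; apply.
  - by move: A1 p0; lra.
  - by move: IH1 p0 hs; lra.
  - by rewrite [in leRHS]exprS; move: IH2; lra.
have [l Hl] := @vector_geometric_cauchy z (s / 2) (fun n => (st n).2).
have la : vnorm (l - a) <= s.
  by have := Hl 0%N; rewrite expr0 /z /=; lra.
exists l; split => //; apply/eqP; rewrite -subr_eq0; apply/eqP; apply: vnorm_eq0.
apply/eqP; rewrite eq_le vnorm_ge0 andbT; apply/ler_addgt0Pr => e e0; rewrite add0r.
have [N HN] := @pow_half_lt R (2 * s) e e0.
have p0 : 0 < s * 2^-1 ^+ N.+1 by rewrite mulr_gt0 // exprn_gt0 // invr_gt0.
have hs : s * 2^-1 ^+ N = 2 * (s * 2^-1 ^+ N.+1) by rewrite exprS; field.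
apply: le_trans (vnorm_tri _ (z N.+1) _) _.
have h1 : vnorm (G l - z N.+1) <= 2^-1 * vnorm (l - z N).
  by apply: HG => //; have := (st N).1; move: p0 hs; lra.
have h2 := Hl N; have h3 := Hl N.+1; rewrite vnormBC in h3.
have h4 := vnorm_ge0 (l - z N).
by move: HN; rewrite -mulrA hs; move: h1 h2 h3 h4 hs p0; lra.
Qed.

(** Newton's map z - (F z - p) J^-1 with the derivative frozen at a is a contraction near a. The
    radius [del] depends on m, r, M and c only, so it is available before F is known. *)
Lemma covering (r M c : R) : 0 < r -> 0 < M -> 0 < c -> exists2 del, 0 < del &
  forall (F : V -> V) a J, entire_map F -> (forall z, vnorm (z - a) <= 3 * r -> vnorm (F z) <= M) ->
    jacobian F a J -> c <= nc (\det J) ->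
    forall p, vnorm (p - F a) <= del -> exists z, vnorm (z - a) <= r /\ F z = p.
Proof.
move=> r0 M0 c0; pose B := 2 * M / r.
have B0 : 0 < B by rewrite divr_gt0 // mulr_gt0.
pose kap := m%:R * (m.-1`!%:R * B ^+ m.-1) / c + 1.
have k0' : 0 <= m%:R * (m.-1`!%:R * B ^+ m.-1) / c.
  by apply: divr_ge0; [rewrite !mulr_ge0 // exprn_ge0 // ltW | exact: ltW].
have k0 : 0 < kap by rewrite /kap; lra.
(* [kap] bounds J^-1, and for this s the Taylor error times [kap] gives the contraction factor 1/2;
   [s / 4 / kap] then bounds the first Newton step by s / 4. *)
pose s := Num.min r (r ^+ 2 / (8 * M * kap)).
have s0 : 0 < s by rewrite lt_min r0 divr_gt0 ?exprn_gt0 // !mulr_gt0.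
exists (s / 4 / kap); first by rewrite !divr_gt0.
move=> F a J HF HM HJ Hc p Hp.
have d0 : \det J != 0 by rewrite -nc_gt0; exact: lt_le_trans c0 Hc.
have JB i j : nc (J i j) <= B.
  apply: (@jacobian_bound F a) => // z zr; apply: HM; apply: le_trans zr _; lra.
have inv w : vnorm (w *m invmx J) <= kap * vnorm w.
  apply: le_trans (invmx_bound (ltW B0) JB d0 w) _; rewrite ler_wpM2r ?vnorm_ge0 //.
  apply: (@le_trans _ _ (m%:R * (m.-1`!%:R * B ^+ m.-1) / c)); last by rewrite /kap; lra.
  rewrite ler_wpM2l // ?lef_pV2 ?posrE ?(lt_le_trans c0 Hc) //.
  by rewrite !mulr_ge0 // exprn_ge0 // ltW.
have uJ : J \in unitmx by rewrite unitmxE unitfE.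
have sr : s <= r by rewrite ge_min lexx.
have s2 : s <= r ^+ 2 / (8 * M * kap) by rewrite ge_min lexx orbT.
have [||z [z1 z2]] := @contraction_solve (fun z => z - (F z - p) *m invmx J) a s s0.
- move=> x y xs ys.
  have -> : x - (F x - p) *m invmx J - (y - (F y - p) *m invmx J) = - ((F x - F y - (x - y) *m J) *m invmx J).
    rewrite !mulmxBl !mulmxK //; move: (F x *m _) (F y *m _) (p *m _) => u v w.
    by apply/rowP => i; rewrite !mxE; ring.
  rewrite vnormN; apply: le_trans (inv _) _.
  have T : vnorm (F x - F y - (x - y) *m J) <= 4 * M / r ^+ 2 * s * vnorm (x - y).
    apply: vnorm_le => [|i].
      by rewrite !mulr_ge0 ?vnorm_ge0 ?invr_ge0 ?sqr_ge0 // ltW.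
    have -> : (F x - F y - (x - y) *m J) 0 i = F x 0 i - F y 0 i - dot (x - y) (col i J).
      by rewrite -vec_dotE !mxE.
    apply: (@entire_taylor R m (fun x => F x 0 i) a (col i J) r s M x y (HF i) r0 sr _ (HJ i) xs ys) => z zr.
    exact: le_trans (nc_vnorm _ _) (HM z zr).
  apply: le_trans (ler_wpM2l (ltW k0) T) _; rewrite mulrA ler_wpM2r ?vnorm_ge0 //.
  apply: (@le_trans _ _ (kap * (4 * M / r ^+ 2 * (r ^+ 2 / (8 * M * kap))))).
    rewrite ler_pM2l // ler_pM2l //; apply: divr_gt0; last exact: exprn_gt0.
    exact: mulr_gt0.
  by rewrite le_eqVlt; apply/orP; left; apply/eqP; field; rewrite !lt0r_neq0.
- have -> : a - (F a - p) *m invmx J - a = (p - F a) *m invmx J.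
    by rewrite addrAC subrr add0r -mulNmx opprB.
  by apply: le_trans (inv _) _; rewrite mulrC -ler_pdivlMr.
exists z; split; first exact: le_trans z1 sr.
have : (F z - p) *m invmx J = 0.
  by move: z2 => /(congr1 (fun x => z - x)); rewrite opprB addrC subrK subrr.
by move/(congr1 (mulmx^~ J)); rewrite mulmxKV // mul0mx => /eqP; rewrite subr_eq0 => /eqP.
Qed.

(** Real coordinates: boundedness on balls is obtained from the extreme value theorem on a compact
    box of real vectors. *)
Definition complex_row (x : 'rV[R]_(m + m)) : V :=
  \row_i (x 0 (lshift m i) +i* x 0 (rshift m i))%C.

Lemma entire_map_bounded (F : V -> V) (rho : R) : entire_map F ->
  exists M, forall z, vnorm z <= rho -> vnorm (F z) <= M.
Proof.
move=> HF; have [rho0|rho0] := ltP rho 0.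
  by exists 0 => z zr; have := vnorm_ge0 z; lra.
pose A := [set x : 'rV[R]_(m + m) | forall i, `[- rho, rho]%classic (x 0 i)].
have cA : compact A.
  by apply: (@rV_compact _ _ (fun=> `[- rho, rho]%classic)) => i; exact: segment_compact.
have nA : A !=set0 by exists 0 => i /=; rewrite mxE in_itv /=; lra.
have cf : continuous (fun x => vnorm (F (complex_row x))).
  move=> x; have [J HJ] := jacobian_exists (complex_row x) HF.
  have [B [r [B0 r0 Hr]]] := jacobian_lip HJ.
  move=> U /nbhs_ballP[e /= e0 He]; apply/nbhs_ballP.
  pose del := Num.min (r / 4) (e / (4 * B)).
  have del0 : 0 < del by rewrite lt_min !divr_gt0 // mulr_gt0.
  have [y1 y2] : del <= r / 4 /\ del <= e / (4 * B) by split; rewrite ge_min lexx ?orbT.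
  exists del => // y xy; apply: He; rewrite /ball /=.
  have n1 : vnorm (complex_row y - complex_row x) <= 2 * del.
    apply: vnorm_le => [|i]; first by rewrite mulr_ge0 // ltW.
    apply: le_trans (nc_le_ReIm _) _; rewrite !mxE /=.
    have nx j : `|y 0 j - x 0 j| <= del by rewrite distrC; apply: ltW; exact: (xy.2 0 j).
    have := nx (lshift m i); have := nx (rshift m i); lra.
  have := Hr (complex_row y - complex_row x); rewrite subrKC => /(_ _) K.
  have {}K : vnorm (F (complex_row y) - F (complex_row x)) <= e / 2.
    apply: le_trans (K _) _; first by apply: le_lt_trans n1 _; move: y1; lra.
    rewrite mulrC -ler_pdivlMr //; apply: le_trans n1 _.
    have -> : e / 2 / B = 2 * (e / (4 * B)) by field; rewrite lt0r_neq0.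
    by rewrite ler_pM2l.
  have := vnormD (F (complex_row y)) (F (complex_row x) - F (complex_row y)).
  have := vnormD (F (complex_row x)) (F (complex_row y) - F (complex_row x)).
  rewrite !subrKC (vnormBC (F (complex_row x))) ltr_norml; move: K; lra.
have [c cin Hc] := EVT_max_rV nA cA (continuous_subspaceT cf).
exists (vnorm (F (complex_row c))) => z zr.
pose x : 'rV[R]_(m + m) := row_mx (\row_i Re (z 0 i)) (\row_i Im (z 0 i)).
have -> : z = complex_row x.
  by apply/rowP => i; rewrite mxE row_mxEl row_mxEr !mxE; case: (z 0 i).
apply: Hc; rewrite inE => i /=; rewrite in_itv /= -ler_norml.
have nz k := le_trans (nc_vnorm z k) zr.
case: (split_ordP i) => k ->; rewrite /x ?row_mxEl ?row_mxEr mxE.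
  exact: (le_trans (ler_Re_nc (z 0 k)) (nz k)).
exact: (le_trans (ler_Im_nc (z 0 k)) (nz k)).
Qed.

End Several.
End QuantitativeEstimates.

(** * The descent through the levels of the net *)

Section Descent.
Variables (R : realType) (m : nat).
Local Notation C := R[i].
Local Notation V := 'rV[C]_m.
Local Notation Re := (@complex.Re R).
Local Notation nc := (@nc R).

Definition covering_radius (r M c del : R) := forall (F : V -> V) a J, entire_map F ->
  (forall z, vnorm (z - a) <= 3 * r -> vnorm (F z) <= M) ->
  jacobian F a J -> c <= nc (\det J) ->
  forall p, vnorm (p - F a) <= del -> exists z, vnorm (z - a) <= r /\ F z = p.

(* The levels of the net: [exp L] bounds the Jacobian determinant of a map that
   is bounded by [a k.+1] on a ball of radius [2^-(k+3)], and the second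
   inequality feeds [L] into [borel_caratheodory] with [eta = 2^-(k+4)]. *)
Definition growth_levels (a : nat -> R) := (forall k, k%:R + 3 <= a k) /\
  (forall k, exists L, m`!%:R * (2 * a k.+1 * 2 ^+ k.+3) ^+ m < expR L /\
    2 * L * expR (16 * 2 ^+ k.+4) <= a k).

Lemma growth_levels_ge1 a k : growth_levels a -> 1 <= a k.
Proof. by move=> [/(_ k) H _]; have := ler0n R k; lra. Qed.

Lemma growth_levels_unbounded a M : growth_levels a -> exists k, M <= a k.
Proof.
move=> [H _]; exists (Num.bound `|M|); set k := Num.bound _; have := H k.
have : `|M| < k%:R by exact: archi_boundP.
have := ler_norm M; lra.
Qed.

Definition level_net (i1 : 'I_m) (a del : nat -> R) (E : set V) := forall k p,
  vnorm p <= a k.+1 -> (exists2 i, i != i1 & a k < nc (p 0 i)) ->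
  exists2 e, E e & vnorm (e - p) <= del k.

Section Step.
Variables (i1 : 'I_m) (a del : nat -> R) (E : set V) (F : V -> V).
Hypotheses (Ha : growth_levels a)
  (Hdel : forall k, covering_radius (2^-1 ^+ k.+3 / 3) (a k.+1) (expR (- a k.+1)) (del k))
  (HE : level_net i1 a del E)
  (HF : entire_map F) (F0 : F 0 = 0)
  (HJ : forall z J, jacobian F z J -> nc (\det J) = expR (Re (F z 0 i1)))
  (avoid : forall z, ~ E (F z)).

(* On slightly smaller balls: coordinates other than [i1] are at most [a k], for
   otherwise [F] hits the net by the covering property; Cauchy's inequality then
   bounds the determinant [exp (Re F_i1)] from above; hence Borel-Caratheodory
   bounds [F_i1]. *)
Lemma descent_step (rho : R) k : 1 <= rho ->
  (forall z, vnorm z <= rho * (2 - 2^-1 ^+ k.+1) -> vnorm (F z) <= a k.+1) ->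
  (forall z, vnorm z <= rho * (2 - 2^-1 ^+ k) -> vnorm (F z) <= a k).
Proof.
move=> rho1 H; have [L [L1 L2]] := Ha.2 k; have a1 j := growth_levels_ge1 j Ha.
(* The two radii differ by 4 rho e = 4 g. Each of the three estimates uses at most g of this:
   covering needs a ball of radius e <= g, Cauchy's inequality one of radius g, Borel-Caratheodory a
   tube of width g. *)
pose e : R := 2^-1 ^+ k.+3; have e0 : 0 < e by rewrite exprn_gt0 // invr_gt0.
pose g := rho * e; have g0 : 0 < g by rewrite mulr_gt0 //; lra.
have eg : e <= g by rewrite /g; have := ler_wpM2r (ltW e0) rho1; lra.
have E1 : 2^-1 ^+ k = 8 * e :> R by rewrite /e !exprS; field.
have E2 : 2^-1 ^+ k.+1 = 4 * e :> R by rewrite /e !exprS; field.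
have ak1 : 0 < a k.+1 by have := a1 k.+1; lra.
have {}H z : vnorm z <= rho * (2 - 8 * e) + 4 * g -> vnorm (F z) <= a k.+1.
  by move=> zr; apply: H; rewrite E2; move: zr; rewrite /g; lra.
rewrite E1; set rk := rho * _ in H *.
have S1 z i : vnorm z <= rk + 3 * g -> i != i1 -> nc (F z 0 i) <= a k.
  move=> zr ii; rewrite leNgt; apply/negP => bad.
  have Fz : vnorm (F z) <= a k.+1 by apply: H; lra.
  have [p Ep pd] := HE Fz (ex_intro2 _ _ i ii bad).
  have [J JJ] := jacobian_exists z HF.
  have [||w [_ wE]] := @Hdel k F z J HF _ JJ _ p pd.
  - move=> w wz; apply: H; have := vnormD z (w - z); rewrite subrKC.
    have E3 : 3 * (2^-1 ^+ k.+3 / 3) = e by rewrite /e; field.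
    by rewrite E3 in wz; lra.
  - rewrite (HJ JJ) ler_expR; have := le_trans (ler_Re_nc _) (le_trans (nc_vnorm _ i1) Fz).
    by rewrite ler_norml => /andP[].
  - by apply: (avoid (z := w)); rewrite wE.
have S2 z : vnorm z <= rk + 2 * g -> Re (F z 0 i1) < L.
  move=> zr; have [J JJ] := jacobian_exists z HF.
  rewrite -ltr_expR -(HJ JJ); apply: le_lt_trans L1; apply: det_bound => i j.
  apply: le_trans (jacobian_bound HF g0 (M := a k.+1) _ JJ i j) _.
    move=> w wz; apply: H; have := vnormD z (w - z); rewrite subrKC; lra.
  have -> : 2 ^+ k.+3 = e^-1 by rewrite /e exprVn invrK.
  by rewrite ler_pM2l ?mulr_gt0 // lef_pV2.
move=> z zr; apply: vnorm_le => [|i]; first by have := a1 k; lra.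
have [->|ii] := eqVneq i i1; last by apply: S1 => //; lra.
apply: le_trans L2.
(* As |z| <= 2 rho, moving the parameter by e / 2 moves the point t z by at most g. *)
have e20 : 0 < e / 2 by rewrite divr_gt0.
have := @borel_caratheodory R (fun t => F (0 + t *: z) 0 i1) (e / 2) L e20.
rewrite scale1r scale0r !add0r F0 mxE.
have -> : 16 / (e / 2) = 16 * 2 ^+ k.+4.
  rewrite /e (exprS 2 k.+3) exprVn; field; exact: expf_neq0.
have dl t : exists d, cdiff (fun t => F (0 + t *: z) 0 i1) t d.
  by have [D HD] := HF i1 (0 + t *: z); exists (dot z D); exact: (cdiff_line (f := fun x => F x 0 i1) HD).
move=> BC; apply: (BC dl erefl); clear BC => t w /andP[t0 t1] wt; apply: S2; rewrite add0r -(subrK t%:C%C w) scalerDl.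
apply: le_trans (vnormD _ _) _; apply: le_trans (lerD (vnormZ _ _) (vnormZ _ _)) _.
rewrite ncR (ger0_norm t0).
have z0 := vnorm_ge0 z.
have h1 := ler_wpM2r z0 wt; have h2 := ler_wpM2r z0 t1.
have rk2 : rk <= 2 * rho by rewrite /rk ; have : 0 <= rho * e; [rewrite mulr_ge0 //; lra|lra].
have h3 : e / 2 * vnorm z <= e / 2 * (2 * rho) by rewrite ler_wpM2l; lra.
by move: g0 h1 h2 h3 zr; rewrite /g; lra.
Qed.

End Step.

(* Descending from a level that bounds [F] on a ball of radius [2 rho] gives
   [|F| <= a 0] on the ball of radius [rho], so that Cauchy's inequality makes
   the determinant at 0 smaller than its value 1. *)
Lemma level_net_unavoidable (i1 : 'I_m) (a del : nat -> R) (E : set V) (F : V -> V) :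
  growth_levels a ->
  (forall k, covering_radius (2^-1 ^+ k.+3 / 3) (a k.+1) (expR (- a k.+1)) (del k)) ->
  level_net i1 a del E -> entire_map F -> F 0 = 0 ->
  (forall z J, jacobian F z J -> nc (\det J) = expR (Re (F z 0 i1))) ->
  exists z, E (F z).
Proof.
move=> Ha Hdel HE HF F0 HJ; apply: contrapT => /forallNP avoid.
have a1 j := growth_levels_ge1 j Ha.
(* With this radius the Jacobian entries at 0 are at most 1 / (2 m!), hence the determinant is at
   most m! (2 m!)^-m <= 1/2. *)
pose rho := 4 * a 0%N * m`!%:R.
have f1 : 1 <= m`!%:R :> R by rewrite ler1n fact_gt0.
have rho1 : 1 <= rho by have := ler_pM ler01 ler01 (a1 0%N) f1; rewrite /rho; lra.
have [M HM] := entire_map_bounded (2 * rho) HF.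
have [K HK] := growth_levels_unbounded M Ha.
have top : forall z, vnorm z <= rho * (2 - 2^-1 ^+ K) -> vnorm (F z) <= a K.
  move=> z zr; apply: le_trans (HM z _) HK; apply: le_trans zr _.
  have : 0 <= rho * 2^-1 ^+ K by rewrite mulr_ge0 ?exprn_ge0 // ?invr_ge0 //; lra.
  lra.
have bot : forall z, vnorm z <= rho * (2 - 2^-1 ^+ 0) -> vnorm (F z) <= a 0%N.
  by elim: K top {HK} => [//|k IH] /(descent_step Ha Hdel HE HF F0 HJ avoid rho1) /IH.
have [J JJ] := jacobian_exists 0 HF.
have rho0 : 0 < rho by lra.
have b2 z : vnorm (z - 0) <= rho -> vnorm (F z) <= a 0%N.
  by rewrite subr0 => zr; apply: bot; rewrite expr0; lra.
have := det_bound (jacobian_bound HF rho0 b2 JJ); rewrite (HJ _ _ JJ) F0 mxE expR0.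
have -> : 2 * a 0%N / rho = (2 * m`!%:R)^-1.
  rewrite /rho; field; rewrite !lt0r_neq0 //; have := a1 0%N; lra.
apply/negP; rewrite -ltNge.
have m0 : (0 < m)%N by exact: leq_ltn_trans (leq0n _) (ltn_ord i1).
set f : R := _%:R in f1 *; rewrite -(prednK m0); set m' := m.-1.
have p1 : (2 * f)^-1 ^+ m' <= 1 by apply: exprn_ile1; rewrite ?invr_ge0 ?invf_le1 //; lra.
rewrite exprS mulrA; have -> : f / (2 * f) = 2^-1 by field; rewrite lt0r_neq0 //; lra.
have : 0 <= (2 * f)^-1 ^+ m' by rewrite exprn_ge0 // invr_ge0; lra.
lra.
Qed.

Lemma factorial_le_expR n : n`!%:R <= expR (n%:R * n%:R) :> R.
Proof.
elim: n => [|n IH]; first by rewrite mulr0 expR0.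
rewrite factS natrM; have n1 : n.+1%:R <= expR n.+1%:R :> R.
  by have := expR_ge1Dx (n.+1%:R : R); lra.
apply: le_trans (ler_pM _ _ n1 IH) _; rewrite ?ler0n // -expRD ler_expR -natr1.
have := ler0n R n; lra.
Qed.

(** Put a k = exp (x k) with x k.+1 = 4 x k, and L = 5 m x k. Of this, 4 m x k comes from the m-th
    power of a k.+1, and the remaining m x k absorbs m! and the powers of 2. In the second
    inequality both 2 L and the exponential of 256 * 2^k are at most exp (x k / 4). *)
Lemma growth_levels_exist : (0 < m)%N -> exists a, growth_levels a.
Proof.
move=> m0; have m1 : 1 <= m%:R :> R by rewrite ler1n.
have [x [xk xS]] : exists x : nat -> R, (forall k, 2048 <= x k /\ m%:R + k%:R + 5 <= x k /\
    m%:R <= x k /\ 256 * 2 ^+ k <= x k / 4) /\ forall k, x k.+1 = 4 * x k.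
  (* The factor 2048 gives x k / 16 >= 128, which makes 10 (x k)^2 smaller than (x k / 16)^4, and
     also 256 * 2^k <= x k / 4. *)
  pose x k : R := 2048 * m%:R * 4 ^+ k.
  exists x; split => k; last by rewrite /x exprS; ring.
  have p4 : k%:R + 1 <= 4 ^+ k :> R.
    elim: k => [|k IH]; first by rewrite add0r expr0.
    by rewrite exprS -natr1; have := ler0n R k; move: IH; lra.
  have p2 : 2 ^+ k <= 4 ^+ k :> R by rewrite lerXn2r ?nnegrE //; lra.
  have k0 := ler0n R k; have p0 : 0 <= 2 ^+ k :> R by rewrite exprn_ge0.
  have mp : 1 * 4 ^+ k <= m%:R * 4 ^+ k :> R by rewrite ler_wpM2r // exprn_ge0.
  have mk : m%:R * 1 <= m%:R * 4 ^+ k :> R by rewrite ler_wpM2l //; lra.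
  have -> : x k = 2048 * (m%:R * 4 ^+ k) by rewrite /x mulrA.
  by move: p4 p2 k0 p0 mp mk; lra.
exists (fun k => expR (x k)); split.
  by move=> k; have := expR_ge1Dx (x k); have := xk k; lra.
move=> k; exists (5 * m%:R * x k); have [x1 [x2 [x3 x4]]] := xk k; split.
  have fm := factorial_le_expR m.
  have tw : 2 * expR (x k.+1) * 2 ^+ k.+3 <= expR (4 * x k + (k%:R + 4)).
    rewrite expRD; rewrite xS.
    have -> : 2 * expR (4 * x k) * 2 ^+ k.+3 = expR (4 * x k) * 2 ^+ k.+4 by rewrite (exprS 2 k.+3); ring.
    rewrite ler_pM2l ?expR_gt0 //.
    have -> : k%:R + 4 = k.+4%:R * 1 :> R by rewrite mulr1 -!natr1; ring.
    rewrite expRM_natl lerXn2r ?nnegrE ?expR_ge0 //.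
    by have := expR_ge1Dx (1 : R); lra.
  have tw0 : 0 <= 2 * expR (x k.+1) * 2 ^+ k.+3 by apply: mulr_ge0; [apply: mulr_ge0; [lra|exact: expR_ge0] | apply: exprn_ge0; lra].
  have tw1 : (2 * expR (x k.+1) * 2 ^+ k.+3) ^+ m <= expR (m%:R * (4 * x k + (k%:R + 4))).
    by rewrite expRM_natl lerXn2r ?nnegrE ?expR_ge0.
  apply: le_lt_trans (ler_pM _ _ fm tw1) _; rewrite ?ler0n ?exprn_ge0 //.
  rewrite -expRD ltr_expR -mulrDr [X in _ < X](_ : _ = m%:R * (5 * x k)); last by ring.
  by rewrite ltr_pM2l; move: x2 m1; lra.
set y := x k in x1 x2 x3 x4 *.
have e4 : 256 * 2 ^+ k = 16 * 2 ^+ k.+4 :> R by rewrite !exprS; ring.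
have h1 : expR (16 * 2 ^+ k.+4) <= expR (y / 4) by rewrite ler_expR -e4.
have h2 : y / 16 <= expR (y / 16) by have := expR_ge1Dx (y / 16); lra.
have h3 : 10 * y ^+ 2 <= expR (y / 4).
  have -> : y / 4 = 4%:R * (y / 16) by field.
  have ty : y = 16 * (y / 16) by field.
  rewrite expRM_natl; apply: (@le_trans _ _ ((y / 16) ^+ 4)); last first.
    by rewrite lerXn2r ?nnegrE ?expR_ge0 //; lra.
  have t1 : 128 <= y / 16 by lra.
  rewrite {1}ty; move: (y / 16) t1 => t t1.
  have t0 : 0 <= t by lra.
  have t2 : 128 * t <= t * t by rewrite ler_wpM2r.
  have -> : 10 * (16 * t) ^+ 2 = (10 * 16 * 16) * t ^+ 2 by ring.
  have -> : t ^+ 4 = (t * t) * t ^+ 2 by ring.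
  by rewrite ler_wpM2r ?sqr_ge0 //; lra.
have h4 : 2 * (5 * m%:R * y) <= 10 * y ^+ 2.
  have : m%:R * y <= y * y by rewrite ler_wpM2r //; lra.
  rewrite expr2; lra.
have y0 : 0 <= y by lra.
have h5 : 0 <= 2 * (5 * m%:R * y) by rewrite !mulr_ge0.
apply: le_trans (ler_pM h5 (expR_ge0 _) (le_trans h4 h3) h1) _.
by rewrite -expRD ler_expR; lra.
Qed.

End Descent.

(** * The net as a sequence of points *)

Section NetSequence.
Variables (R : realType) (m : nat).
Local Notation C := R[i].
Local Notation V := 'rV[C]_m.
Local Notation nc := (@nc R).

Lemma avoid_finite (q : C) (e : R) (l : seq C) : 0 < e -> exists c, nc (c - q) <= e /\ c \notin l.
Proof.
move=> e0; pose t (k : nat) : C := q + (e / k.+1%:R)%:C%C.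
have tinj : injective t.
  move=> j k /addrI /complexI /(mulfI (lt0r_neq0 e0)) /invr_inj /eqP.
  by rewrite eqr_nat => /eqP [].
have [all_in|] := boolP (all (mem l) (map t (iota 0 (size l).+1))).
  have := uniq_leq_size (s1 := map t (iota 0 (size l).+1)) (s2 := l).
  rewrite map_inj_uniq // iota_uniq size_map size_iota ltnn => /(_ isT (allP all_in)) //.
move=> /allPn [c /mapP [k _ ->] kl]; exists (t k); split => //.
rewrite /t addrC addKr ncR ger0_norm ?divr_ge0 ?(ltW e0) //.
by rewrite ler_pdivrMr // ler_peMr ?(ltW e0) ?ler1n.
Qed.

Lemma injective_perturbation (q : nat -> C) (e : nat -> R) : (forall n, 0 < e n) ->
  exists2 c : nat -> C, injective c & forall n, nc (c n - q n) <= e n.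
Proof.
move=> e0; have [f Hf] := choice (fun nl : nat * seq C => avoid_finite (q nl.1) nl.2 (e0 nl.1)).
(* [L n] lists the first n chosen values; the next one is chosen off this list. *)
pose L := fix L n := if n is k.+1 then rcons (L k) (f (k, L k)) else [::].
have inL j n : (j < n)%N -> f (j, L j) \in L n.
  elim: n => [//|n IH]; rewrite ltnS leq_eqVlt /= mem_rcons inE => /orP[/eqP ->|/IH ->].
    by rewrite eqxx.
  by rewrite orbT.
exists (fun n => f (n, L n)) => [j k jk|n]; last exact: (Hf (n, L n)).1.
have ne a b : (a < b)%N -> f (a, L a) <> f (b, L b).
  by move=> /inL ab E; have := (Hf (b, L b)).2; rewrite -E ab.
by case: (ltngtP j k) => // h; [case: (ne j k h) | case: (ne k j h)].
Qed.

Lemma grid_approx (c h r : R) (N : nat) : 0 < h -> 2 * c / h < N%:R -> `|r| <= c ->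
  exists u : 'I_N, `|r - (h * u%:R - c)| <= h.
Proof.
move=> h0 hN; rewrite ler_norml => /andP[r1 r2].
have x0 : 0 <= (r + c) / h by rewrite divr_ge0 ?(ltW h0) //; lra.
have /andP[t1 t2] := truncn_itv x0.
have uN : (Num.truncn ((r + c) / h) < N)%N.
  rewrite -(ltr_nat R); apply: le_lt_trans t1 (le_lt_trans _ hN).
  by rewrite ler_pM2r ?invr_gt0 //; lra.
exists (Ordinal uN) => /=; rewrite ler_pdivlMr // in t1; rewrite ltr_pdivrMr // -natr1 in t2.
by rewrite ler_norml; move: t1 t2; lra.
Qed.

Section Grid.
Variables (a h : nat -> R) (N : nat -> nat).

Definition grid_point k (x : {ffun 'I_m -> 'I_(N k) * 'I_(N k)}) : V :=
  \row_i Complex (h k * (x i).1%:R - a k.+1) (h k * (x i).2%:R - a k.+1).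

Definition grid_index := {k : nat & {ffun 'I_m -> 'I_(N k) * 'I_(N k)}}.

Definition grid_code k (x : {ffun 'I_m -> 'I_(N k) * 'I_(N k)}) : nat :=
  pickle (Tagged (fun k => {ffun 'I_m -> 'I_(N k) * 'I_(N k)}) x : grid_index).

Definition level_code_bound k := \max_(x : {ffun 'I_m -> 'I_(N k) * 'I_(N k)}) grid_code x.

End Grid.

(* Level [k] of the net is a finite grid, indexed by codes in [nat]; codes that
   are not used get filler points, so that the sequence is indexed by all of
   [nat]. A small perturbation makes the coordinates [i0] distinct. *)
Lemma net_sequence (i0 i1 : 'I_m) (a del : nat -> R) : i0 != i1 ->
  (forall k, k%:R + 3 <= a k) -> (forall k, 0 < del k) ->
  exists (p : nat -> V) (s : nat -> 'I_m), [/\ injective (fun n => p n 0 i0),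
    forall n, s n != i1, forall M, exists n0, forall n, (n0 <= n)%N -> M <= nc (p n 0 (s n)),
    forall n, p n 0 (s n) != 0 & level_net i1 a del (range p)].
Proof.
(* A point of the box is within 2 h of the grid, h for each of the real and imaginary parts, and the
   perturbation costs another h: 3 h <= [del]. The cap 1 keeps all changes of a coordinate below
   1. *)
move=> i01 Ha del0; pose h k := Num.min (del k) 1 / 3.
have h0 k : 0 < h k by rewrite divr_gt0 // lt_min del0 /=.
have h1 k : h k <= 3^-1 by rewrite /h ler_pdivrMr // mulVf // ge_min lexx orbT.
have hd k : 3 * h k <= del k by rewrite /h mulrC divfK // ge_min lexx.
pose N k := Num.bound (2 * a k.+1 / h k).
have HN k : 2 * a k.+1 / h k < (N k)%:R.
  apply: archi_boundP; rewrite divr_ge0 ?(ltW (h0 _)) // mulr_ge0 //.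
  by have := Ha k.+1; have := ler0n R k.+1; lra.
(* The slack 1 covers the passage from a point with a coordinate above [a k] to its grid
   approximation. *)
pose good k x i := i != i1 /\ a k - 1 < nc (@grid_point a h N k x 0 i).
have ch n : exists qse : V * 'I_m * R, [/\ 0 < qse.2, qse.2 <= 3^-1, qse.1.2 != i1,
    forall k (x : {ffun 'I_m -> 'I_(N k) * 'I_(N k)}), grid_code x = n -> (exists i, good k x i) ->
       qse.1.1 = grid_point a h x /\ qse.2 = h k &
    n%:R + 3 <= nc (qse.1.1 0 qse.1.2) \/ exists k (x : {ffun 'I_m -> 'I_(N k) * 'I_(N k)}),
       grid_code x = n /\ a k - 1 < nc (qse.1.1 0 qse.1.2)].
  have [[k [x [E [i gi]]]]|no] := pselect (exists k (x : {ffun 'I_m -> 'I_(N k) * 'I_(N k)}),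
      grid_code x = n /\ exists i, good k x i).
    exists (grid_point a h x, i, h k); split => //=; first exact: gi.1.
      move=> l y Ey _; have : grid_code x = grid_code y by rewrite E Ey.
      move=> /(pcan_inj pickleK) Exy.
      (* The two grid points agree only as dependent pairs, so the claim is phrased as a predicate
         of the pair before rewriting. *)
      pose Q (w : grid_index N) := grid_point a h x = grid_point a h (tagged w) /\ h k = h (tag w).
      by rewrite -[_ /\ _]/(Q (Tagged _ y)) -Exy.
    by right; exists k, x; split => //; exact: gi.2.
  (* The filler point: its coordinates grow with n, so it also tends to infinity and has a nonzero
     coordinate [i0] after perturbation. *)
  exists (const_mx (n + 3)%:R, i0, 3^-1); split => //=.
    by move=> k x E ex; case: no; exists k, x.
  by left; rewrite mxE nc_nat natrD.
have [qse Hq] := choice ch.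
pose q n := (qse n).1.1; pose s n := (qse n).1.2; pose e n := (qse n).2.
have e0 n : 0 < e n by case: (Hq n).
have [c cinj Hc] := injective_perturbation (fun n => q n 0 i0) e0.
pose p n : V := \row_i if i == i0 then c n else q n 0 i.
have pq n : vnorm (p n - q n) <= e n.
  apply: vnorm_le => [|i]; first exact: ltW.
  rewrite !mxE; case: eqP => [->|_]; first exact: Hc.
  by rewrite subrr nc0 ltW.
have ps n : nc (q n 0 (s n)) - 3^-1 <= nc (p n 0 (s n)).
  have [_ e3 _ _ _] := Hq n; have := le_trans (nc_vnorm _ (s n)) (pq n).
  have -> : (p n - q n) 0 (s n) = p n 0 (s n) - q n 0 (s n) by rewrite !mxE.
  have := ncD (q n 0 (s n) - p n 0 (s n)) (p n 0 (s n)); rewrite subrK ncBC.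
  by move: e3; rewrite -/(e n); lra.
exists p, s; split.
- by move=> j k; rewrite !mxE eqxx; exact: cinj.
- by move=> n; case: (Hq n).
- move=> M; pose K := Num.bound `|M|; have HK : M <= K%:R.
    by apply: le_trans (ler_norm _) _; apply: ltW; exact: archi_boundP.
  (* Each level has finitely many codes. Beyond those of the levels below K, a point is either a
     filler of size at least K or belongs to a level at least K. *)
  exists (maxn K (\max_(k < K) level_code_bound N k).+1) => n; rewrite geq_max => /andP[Kn Bn].
  apply: le_trans (ps n); have [_ _ _ _ [big|[k [x [E big]]]]] := Hq n.
    by rewrite -(ler_nat R) in Kn; rewrite -/(q n) -/(s n) in big; lra.
  have Kk : (K <= k)%N.
    rewrite leqNgt; apply/negP => kK; move: Bn; rewrite ltnNge => /negP; apply.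
    apply: leq_trans (leq_bigmax (Ordinal kK)); rewrite -E /level_code_bound /=.
    exact: leq_bigmax.
  rewrite -(ler_nat R) in Kk; rewrite -/(q n) -/(s n) in big.
  by have := Ha k; lra.
- move=> n; rewrite -nc_gt0; apply: lt_le_trans (ps n).
  have [_ _ _ _ [big|[k [x [_ big]]]]] := Hq n; rewrite -/(q n) -/(s n) in big.
    by have := ler0n R n; lra.
  by have := Ha k; have := ler0n R k; lra.
- move=> k z zr [i ii zi].
  have ch2 j : exists u : 'I_(N k) * 'I_(N k),
      nc (z 0 j - Complex (h k * u.1%:R - a k.+1) (h k * u.2%:R - a k.+1)) <= 2 * h k.
    have zj := le_trans (nc_vnorm z j) zr.
    have [u Hu] := grid_approx (h0 k) (HN k) (le_trans (ler_Re_nc _) zj).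
    have [v Hv] := grid_approx (h0 k) (HN k) (le_trans (ler_Im_nc _) zj).
    exists (u, v); apply: le_trans (nc_le_ReIm _) _; rewrite ReB ImB /=; lra.
  have [x Hx] := choice ch2; pose y := [ffun j => x j].
  have yz : vnorm (z - grid_point a h y) <= 2 * h k.
    apply: vnorm_le => [|j]; first by have := h0 k; lra.
    by rewrite !mxE ffunE; exact: Hx.
  have gy : good k y i.
    split => //; have := le_trans (nc_vnorm _ i) yz.
    have -> : (z - grid_point a h y) 0 i = z 0 i - grid_point a h y 0 i by rewrite [LHS]mxE [X in _ + X]mxE.
    have := ncD (z 0 i - grid_point a h y 0 i) (grid_point a h y 0 i); rewrite subrK.
    by have := h1 k; lra.
  have [_ _ _ /(_ k y erefl (ex_intro _ i gy)) [Eq Ee] _] := Hq (grid_code y).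
  exists (p (grid_code y)); first by exists (grid_code y).
  have := pq (grid_code y); rewrite /e Ee /q Eq => pq1.
  apply: le_trans (vnorm_tri _ (grid_point a h y) _) _; rewrite (vnormBC _ z).
  by have := hd k; lra.
Qed.

End NetSequence.

(** * Locally uniform limits and interpolation by entire functions *)

Section Interpolation.
Variables (R : realType) (m : nat).
Local Notation C := R[i].
Local Notation V := 'rV[C]_m.
Local Notation nc := (@nc R).

Lemma nc_small_eq (x y : C) : (forall e, 0 < e -> nc (x - y) <= e) -> x = y.
Proof.
move=> H; apply/eqP; rewrite -subr_eq0 -nc_eq0 eq_le nc_ge0 andbT.
by apply/ler_addgt0Pr => e e0; rewrite add0r; exact: H.
Qed.

Lemma pow_half_ler j n : (j <= n)%N -> 2^-1 ^+ n <= 2^-1 ^+ j :> R.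
Proof. by move=> jn; apply: ler_wiXn2l jn; rewrite ?invr_ge0 ?invf_le1 //; lra. Qed.

Section Limit.
Variables (H : nat -> V -> C) (rho : nat -> R).
Hypotheses (HH : forall n, entire (H n))
  (Hrho : forall M, exists n0, forall n, (n0 <= n)%N -> M <= rho n)
  (Hstep : forall n x, vnorm x <= rho n -> nc (H n.+1 x - H n x) <= 2^-1 ^+ n.+1).

(** As [rho] need not be monotone, the estimate is claimed from those n on after which every [rho k]
    dominates |x|. The limit at x is formed from the least such n, so that a single value serves all
    of them. *)
Lemma limit_exists : exists h : V -> C, forall x n, (forall k, (n <= k)%N -> vnorm x <= rho k) ->
  nc (h x - H n x) <= 2 * 2^-1 ^+ n.
Proof.
suff ch x : exists l, forall n, (forall k, (n <= k)%N -> vnorm x <= rho k) ->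
    nc (l - H n x) <= 2 * 2^-1 ^+ n by have [h Hh] := choice ch; exists h.
have ex0 : exists n, `[< forall k, (n <= k)%N -> vnorm x <= rho k >].
  by have [n0 Hn0] := Hrho (vnorm x); exists n0; apply/asboolP.
case: (ex_minnP ex0) => n0 /asboolP Q0 minQ.
have st k : nc (H (n0 + k.+1)%N x - H (n0 + k)%N x) <= 2^-1 ^+ n0 * 2^-1 ^+ k.+1.
  by rewrite -exprD addnS; apply: Hstep; apply: Q0; exact: leq_addr.
have [l Hl] := complex_geometric_cauchy st.
exists l => n Qn; have nn : (n0 <= n)%N by apply: minQ; apply/asboolP.
by have := Hl (n - n0)%N; rewrite subnKC // -mulrA -exprD subnKC.
Qed.

(** Weierstrass's theorem. Cauchy's inequality for the differences H k - H n makes the gradients at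
    z converge geometrically; the same differences are Lipschitz near z with constant 8 * 2^-n,
    which passes to h - H n. *)
Lemma limit_entire (h : V -> C) :
  (forall x n, (forall k, (n <= k)%N -> vnorm x <= rho k) -> nc (h x - H n x) <= 2 * 2^-1 ^+ n) ->
  entire h.
Proof.
move=> Hh z; have [n1 Hn1] := Hrho (vnorm z + 2).
have near_z x n : vnorm (x - z) <= 2 -> (n1 <= n)%N -> nc (h x - H n x) <= 2 * 2^-1 ^+ n.
  move=> xz nn; apply: Hh => k nk; apply: le_trans (Hn1 k (leq_trans nn nk)).
  by rewrite -{1}(subrK z x) addrC; apply: le_trans (vnormD _ _) _; rewrite lerD2l.
have diff x n k : vnorm (x - z) <= 2 -> (n1 <= n)%N -> (n <= k)%N ->
    nc (H k x - H n x) <= 4 * 2^-1 ^+ n.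
  move=> xz nn nk; have := near_z x n xz nn; have := near_z x k xz (leq_trans nn nk).
  have := ncB (h x - H n x) (h x - H k x); rewrite (_ : _ - _ - _ = H k x - H n x); last by ring.
  have := pow_half_ler nk; lra.
have HB k n : entire (fun x => H k x - H n x) by exact: entireB.
have [D HD] := choice (fun n => HH n z).
have dD n k i : (n1 <= n)%N -> (n <= k)%N -> nc (D k i 0 - D n i 0) <= 8 * 2^-1 ^+ n.
  move=> nn nk.
  have := @entire_cauchy R m _ z _ 1 (4 * 2^-1 ^+ n) (HB k n) ltr01 _ (vdiffB (HD k) (HD n)) (delta_mx 0 i).
  rewrite dot_delta !mxE divr1 => K.
  have d1 : vnorm (delta_mx 0 i : V) <= 1.
    by apply: vnorm_le => // j; rewrite mxE; case: (_ && _); rewrite ?nc1 ?nc0.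
  have p0 : 0 <= 2^-1 ^+ n :> R by rewrite exprn_ge0 // invr_ge0.
  apply: le_trans (K _) _; first by move=> x xz; apply: diff => //; lra.
  by have := ler_wpM2l (mulr_ge0 (ler0n R 8) p0) d1; lra.
have chD i : exists l, forall j, nc (l - D (n1 + j)%N i 0) <= 2 * (16 * 2^-1 ^+ n1) * 2^-1 ^+ j.
  apply: complex_geometric_cauchy => j; rewrite addnS.
  apply: le_trans (dD _ _ i (leq_addr j n1) (leqnSn _)) _.
  by rewrite -mulrA exprD (exprS _ j) le_eqVlt; apply/orP; left; apply/eqP; field.
have [d Hd] := choice chD; pose Dl : 'cV[C]_m := \col_i d i.
exists Dl => e e0.
(* 8 is for the Lipschitz constant of h - H n, 32 m for the distance between the gradient of H n and
   its limit; the other e / 2 is left for the differentiability of H n. *)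
have [j0 Hj0] := @pow_half_lt R (8 + 32 * m%:R) (e / 2) ltac:(by rewrite divr_gt0).
pose n := (n1 + j0)%N; have nn : (n1 <= n)%N by exact: leq_addr.
have nj : 2^-1 ^+ n <= 2^-1 ^+ j0 :> R by apply: pow_half_ler; exact: leq_addl.
have e2 : 0 < e / 2 by rewrite divr_gt0.
have [r r0 Hr] := HD n _ e2.
exists (Num.min r 1) => [|w]; first by rewrite lt_min r0 ltr01.
rewrite lt_min => /andP[/Hr K1 w1].
have wz : vnorm (z + w - z) <= 1 by rewrite addrC addKr ltW.
have zz : vnorm (z - z) <= 1 by rewrite subrr vnorm0.
have K2 : nc (h (z + w) - H n (z + w) - (h z - H n z)) <= 8 * 2^-1 ^+ n * vnorm w.
  apply/ler_addgt0Pr => t t0; have [k0 Hk0] := @pow_half_lt R 4 t t0.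
  pose k := maxn k0 n; have kn : (n <= k)%N by exact: leq_maxr.
  have kk : 2^-1 ^+ k <= 2^-1 ^+ k0 :> R by apply: pow_half_ler; exact: leq_maxl.
  have L := @entire_lipschitz R m _ z (z + w) z 1 1 (4 * 2^-1 ^+ n) (HB k n) ltr01 _ wz zz.
  have {}L : nc (H k (z + w) - H n (z + w) - (H k z - H n z)) <= 8 * 2^-1 ^+ n * vnorm w.
    apply: le_trans (L _) _; first by move=> x xz; apply: diff => //; lra.
    by rewrite (addrC z) addrK divr1; lra.
  have A1 : nc (h (z + w) - H k (z + w)) <= 2 * 2^-1 ^+ k.
    by apply: near_z (leq_trans nn kn); lra.
  have A2 : nc (h z - H k z) <= 2 * 2^-1 ^+ k.
    by apply: near_z (leq_trans nn kn); lra.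
  rewrite (_ : h (z + w) - H n (z + w) - (h z - H n z) = (H k (z + w) - H n (z + w) - (H k z - H n z)) +
    ((h (z + w) - H k (z + w)) - (h z - H k z))); last by ring.
  apply: le_trans (ncD _ _) _; have := ncB (h (z + w) - H k (z + w)) (h z - H k z); lra.
have K3 : nc (dot w (D n - Dl)) <= 32 * m%:R * 2^-1 ^+ n * vnorm w.
  apply: le_trans (nc_dot _ _) _; rewrite ler_wpM2r ?vnorm_ge0 // /gnorm.
  have -> : 32 * m%:R * 2^-1 ^+ n = \sum_(i < m) 32 * 2^-1 ^+ n :> R.
    by rewrite sumr_const card_ord -[RHS]mulr_natl; ring.
  apply: ler_sum => i _; rewrite !mxE ncBC; apply: le_trans (Hd i j0) _.
  by rewrite /n exprD le_eqVlt; apply/orP; left; apply/eqP; ring.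
rewrite (_ : h (z + w) - h z - dot w Dl = (h (z + w) - H n (z + w) - (h z - H n z)) +
   ((H n (z + w) - H n z - dot w (D n)) + dot w (D n - Dl))); last by rewrite dotBr; ring.
apply: le_trans (ncD _ _) _; have := ncD (H n (z + w) - H n z - dot w (D n)) (dot w (D n - Dl)).
have w0 := vnorm_ge0 w.
have c0 : 0 <= 8 + 32 * m%:R :> R by have := ler0n R m; lra.
have c1 := le_trans (ler_wpM2l c0 nj) (ltW Hj0).
have := ler_wpM2r w0 c1; lra.
Qed.

End Limit.

(* Newton interpolation in the coordinate [i0]; a high power of
   [x_(s j) / p_j_(s j)], which is at most 1/2 in modulus on the polydisc of
   radius [rho j], makes the [j]-th term small there. *)
Lemma interpolation (i0 : 'I_m) (p : nat -> V) (s : nat -> 'I_m) (t : nat -> C) :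
  injective (fun n => p n 0 i0) ->
  (forall M, exists n0, forall n, (n0 <= n)%N -> M <= nc (p n 0 (s n))) ->
  (forall n, p n 0 (s n) != 0) ->
  exists h : V -> C, [/\ entire h, forall n, h (p n) = t n &
    forall x y : V, x 0 i0 = y 0 i0 -> (forall n, x 0 (s n) = y 0 (s n)) -> h x = h y].
Proof.
move=> inj poo p0.
(* Dependence on the listed coordinates only. It survives the limit, and it makes shears along any
   other coordinate invertible. *)
pose dep (f : V -> C) := forall x y : V, x 0 i0 = y 0 i0 -> (forall n, x 0 (s n) = y 0 (s n)) -> f x = f y.
pose rho n := nc (p n 0 (s n)) / 2.
have ch (jf : nat * (V -> C)) : exists G : V -> C, [/\ entire jf.2 -> entire G, dep jf.2 -> dep G,
    G (p jf.1) = t jf.1, forall i, (i < jf.1)%N -> G (p i) = jf.2 (p i) &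
    forall x, vnorm x <= rho jf.1 -> nc (G x - jf.2 x) <= 2^-1 ^+ jf.1.+1].
  case: jf => j f /=; pose c := t j - f (p j).
  (* [A] bounds the Newton product on the polydisc of radius [rho j]; the exponent [N] is then taken
     with |c| A 2^-N < 2^-(j+1). *)
  pose A := \prod_(i < j) ((rho j + nc (p i 0 i0)) / nc (p j 0 i0 - p i 0 i0)).
  have j0 : 0 < 2^-1 ^+ j.+1 :> R by rewrite exprn_gt0 // invr_gt0.
  have [N HN] := @pow_half_lt R (nc c * A) _ j0.
  pose B (x : V) := \prod_(i < j) ((x 0 i0 - p i 0 i0) / (p j 0 i0 - p i 0 i0)) *
    (x 0 (s j) / p j 0 (s j)) ^+ N.
  have dist i : (i < j)%N -> p j 0 i0 - p i 0 i0 != 0.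
    move=> ij; rewrite subr_eq0; apply/eqP => /inj ji; by rewrite ji ltnn in ij.
  exists (fun x => f x + c * B x); split.
  - move=> Hf; apply: entireD Hf (entireM (entire_cst _) (entireM _ (entireX _ _))).
      apply: entire_prod => i; apply: entireM (entireB (entire_coord _) (entire_cst _)) (entire_cst _).
    exact: entireM (entire_coord _) (entire_cst _).
  - by move=> Df x y xy0 xys; rewrite /B (Df x y) // xy0 xys.
  - rewrite /B divff // expr1n mulr1 big1 ?mulr1 ?/c ?subrKC // => i _.
    by rewrite divff // dist.
  - by move=> i ij; rewrite /B (bigD1 (Ordinal ij)) //= subrr !mul0r mulr0 addr0.
  - move=> x xr; rewrite addrAC subrr add0r ncM; apply: le_trans (ltW HN).
    rewrite -mulrA ler_wpM2l ?nc_ge0 // /B ncM; apply: ler_pM; rewrite ?nc_ge0 //.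
      rewrite nc_prod; apply: ler_prod => i _; rewrite nc_ge0 /= ncM ncV.
      rewrite ler_wpM2r ?invr_ge0 ?nc_ge0 //; apply: le_trans (ncB _ _) _.
      by rewrite lerD2r; exact: le_trans (nc_vnorm _ _) xr.
    rewrite ncX lerXn2r ?nnegrE ?nc_ge0 ?invr_ge0 // ncM ncV ler_pdivrMr ?nc_gt0 //.
    by rewrite mulrC; exact: le_trans (nc_vnorm _ _) xr.
have [f Hf] := choice ch.
pose H := fix H n : V -> C := if n is k.+1 then f (k, H k) else fun=> 0.
have HE n : entire (H n).
  by elim: n => [|n IH]; [exact: entire_cst | case: (Hf (n, H n)) => /(_ IH)].
have Hdep n : dep (H n).
  by elim: n => [|n IH]; [|case: (Hf (n, H n)) => _ /(_ IH)].
have Hval i n : (i < n)%N -> H n (p i) = t i.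
  elim: n => [//|n IH]; rewrite ltnS leq_eqVlt; have [_ _ e1 e2 _] := Hf (n, H n).
  by case/orP => [/eqP ->|ij]; [exact: e1 | rewrite /= e2 //; exact: IH].
have Hrho M : exists n0, forall n, (n0 <= n)%N -> M <= rho n.
  have [n0 Hn0] := poo (2 * M); exists n0 => n /Hn0; rewrite /rho; lra.
have Hst n x : vnorm x <= rho n -> nc (H n.+1 x - H n x) <= 2^-1 ^+ n.+1.
  by case: (Hf (n, H n)) => _ _ _ _; apply.
have [h Hh] := limit_exists Hrho Hst.
have close x e : 0 < e -> exists n0, forall n, (n0 <= n)%N -> nc (h x - H n x) <= e.
  move=> e0; have [j Hj] := @pow_half_lt R 2 e e0; have [n0 Hn0] := Hrho (vnorm x).
  exists (maxn j n0) => n; rewrite geq_max => /andP[jn nn].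
  have := Hh x n (fun k nk => Hn0 k (leq_trans nn nk)); have := pow_half_ler jn; lra.
exists h; split; first exact: limit_entire Hh.
  move=> n; apply: nc_small_eq => e e0; have [n0 Hn0] := close (p n) e e0.
  by rewrite -(Hval n (maxn n0 n.+1)) ?leq_maxr //; apply: Hn0; exact: leq_maxl.
move=> x y xy0 xys; apply: nc_small_eq => e e0.
have e2 : 0 < e / 2 by rewrite divr_gt0.
have [n0 Hn0] := close x _ e2; have [n1 Hn1] := close y _ e2.
have := Hn0 (maxn n0 n1) (leq_maxl _ _); have := Hn1 (maxn n0 n1) (leq_maxr _ _).
rewrite (Hdep _ x y xy0 xys); set a := H _ y.
have := ncB (h x - a) (h y - a); rewrite (_ : h x - a - (h y - a) = h x - h y); last by ring.
lra.
Qed.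

End Interpolation.

(** * Comparison with the library's norm and differential *)

Section Bridge.
Variables (R : realType) (m : nat).
Local Notation C := R[i].
Local Notation V := 'rV[C]_m.
Local Notation nc := (@nc R).
Local Notation Re := (@complex.Re R).

Lemma norm_vnorm (v : V) : `|v| = (vnorm v)%:C%C.
Proof.
have ub j : (nc (v 0 j))%:C%C <= `|v|.
  rewrite -nc_norm [leRHS]/Num.Def.normr /= mx_normE.
  rewrite [leLHS](_ : _ = `|v 0 j|%:nng%:num) // num_le.
  by apply/bigmax_geP; right; exists (0, j).
have [v0|v0] := eqVneq (mx_norm v) 0.
  by rewrite (mx_norm_eq0 v0) normr0 vnorm0.
have [[i j] /= E] := mx_norm_neq0 v0; rewrite (ord1 i) in E.
have E' : `|v| = (nc (v 0 j))%:C%C by exact: E.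
rewrite E'; congr (_%:C%C); apply/eqP; rewrite eq_le nc_vnorm /=.
by apply: vnorm_le => [|k]; [exact: nc_ge0 | rewrite -lecR -E'; exact: ub].
Qed.

Lemma posc_real (e : C) : 0 < e -> e = (Re e)%:C%C /\ 0 < Re e.
Proof.
rewrite ltcE /= => /andP[/eqP e1 e2]; split => //.
by case: e e1 e2 => a b /= -> _.
Qed.

Lemma nbhs_vnormP (z : V) (A : set V) :
  nbhs z A <-> exists2 r : R, 0 < r & forall w, vnorm w < r -> A (z + w).
Proof.
split.
  move=> /nbhs_ballP [e /= e0 He]; have [eE re] := posc_real e0.
  exists (Re e) => // w wr; apply: He; rewrite -ball_normE /ball_ /=.
  by rewrite opprD addrA subrr add0r normrN norm_vnorm eE ltcR.
move=> [r r0 Hr]; apply/nbhs_ballP; exists r%:C%C; first by rewrite /= ltcR.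
move=> y; rewrite -ball_normE /ball_ /= norm_vnorm ltcR vnormBC => yz.
by rewrite -(subrKC z y); exact: Hr.
Qed.

Lemma differentiable_jacobian (f : V -> V) z : differentiable f z ->
  jacobian f z (lin1_mx ('d f z)).
Proof.
move=> /diff_locallyP [_ /eqaddoP E] i e e0.
have /nbhs_vnormP [r r0 Hr] := E e%:C%C (ltac:(by rewrite ltcR)).
exists r => // w /Hr; rewrite add0r /= !norm_vnorm -rmorphM lecR => /(le_trans (nc_vnorm _ i)).
rewrite -vec_dotE mul_rV_lin1 !fctE /= (addrC w) !mxE opprD addrA; exact.
Qed.

Lemma jacobian_differentiable (f : V -> V) z J : jacobian f z J -> differentiable f z.
Proof.
move=> HJ; pose df : {linear V -> V} := mulmxr J.
have cdf : continuous df.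
  move=> x U /nbhs_vnormP [r r0 Hr]; apply/nbhs_vnormP.
  pose B := \sum_i gnorm (col i J).
  have B0 : 0 <= B by apply: sumr_ge0 => i _; exact: gnorm_ge0.
  exists (r / (B + 1)); first by rewrite divr_gt0 //; lra.
  move=> w wr; rewrite /preimage /= mulmxDl; apply: Hr.
  rewrite ltr_pdivlMr in wr; last lra.
  apply: le_lt_trans wr; apply: vnorm_le => [|i].
    by rewrite mulr_ge0 ?vnorm_ge0 //; lra.
  rewrite vec_dotE mulrC; apply: le_trans (nc_dot _ _) _.
  rewrite ler_wpM2r ?vnorm_ge0 // /B (bigD1 i) //=.
  have : 0 <= \sum_(j < m | j != i) gnorm (col j J) by apply: sumr_ge0 => j _; exact: gnorm_ge0.
  lra.
have E (e : C) : 0 < e -> \forall w \near (0 : V), `|f (w + z) - (f z + df w)| <= e * `|w|.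
  move=> /posc_real [eE re].
  have [r Hr] := choice (fun i => let: ex_intro2 r a b := HJ i _ re in
    ex_intro (fun r => 0 < r /\ forall w, vnorm w < r ->
      nc (f (z + w) 0 i - f z 0 i - dot w (col i J)) <= Re e * vnorm w) r (conj a b)).
  apply/nbhs_vnormP; exists (\big[Num.min/1]_i r i).
    by apply: lt_bigmin => // i _; exact: (Hr i).1.
  move=> w wr; rewrite add0r /= !norm_vnorm eE -rmorphM lecR.
  apply: vnorm_le => [|i]; first by rewrite mulr_ge0 ?vnorm_ge0 // ltW.
  have wi : vnorm w < r i by apply: lt_le_trans wr _; exact: bigmin_le_cond.
  have := (Hr i).2 w wi; rewrite -vec_dotE.
  by rewrite (addrC w) !mxE opprD addrA; exact.
have U : 'd f z = df :> (V -> V) by apply: (diff_unique cdf); apply/eqaddoP; exact: E.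
by apply/diff_locallyP; rewrite U; split => //; apply/eqaddoP; exact: E.
Qed.

Lemma holomorphic_entire_map (f : V -> V) : holomorphic f -> entire_map f.
Proof. by move=> Hf i z; eexists; exact: (differentiable_jacobian (Hf z) i). Qed.

Lemma entire_map_holomorphic (f : V -> V) : entire_map f -> holomorphic f.
Proof.
by move=> Hf z; have [J HJ] := jacobian_exists z Hf; exact: jacobian_differentiable HJ.
Qed.

(** Cauchy's inequality with M = 0 for the zero function f - f, which has gradient D - E at z. *)
Lemma vdiff_unique (f : V -> C) z D E : entire f -> vdiff f z D -> vdiff f z E -> D = E.
Proof.
move=> Hf HD HE; apply/colP => i; apply/eqP; rewrite -subr_eq0 -nc_eq0 eq_le nc_ge0 andbT.
have := @entire_cauchy R m _ z _ 1 0 (entireB Hf Hf) ltr01 _ (vdiffB HD HE) (delta_mx 0 i).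
rewrite dot_delta !mxE mulr0 !mul0r; apply => x _.
by rewrite subrr nc0.
Qed.

Lemma jacobian_unique (f : V -> V) z J K : entire_map f -> jacobian f z J -> jacobian f z K -> J = K.
Proof.
move=> Hf HJ HK; apply/matrixP => i j.
by have /colP /(_ i) := vdiff_unique (Hf j) (HJ j) (HK j); rewrite !mxE.
Qed.

End Bridge.

(** * The determinant of a symplectic map *)

Section SymplecticDeterminant.
Variables (R : realType) (n : nat).
Local Notation C := R[i].
Local Notation V := 'rV[C]_(2 * n).
Local Notation nc := (@nc R).

Let fs (k : 'I_n) := Ordinal (ltn_fst_index k).
Let sn (k : 'I_n) := Ordinal (ltn_snd_index k).

Definition symplectic_matrix : 'M[C]_(2 * n) :=
  \sum_(k < n) (delta_mx (fs k) (sn k) - delta_mx (sn k) (fs k)).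

Lemma mul_row_delta (u : V) i j k : (u *m (delta_mx i j : 'M[C]_(2 * n))) 0 k = u 0 i * (k == j)%:R.
Proof.
rewrite mxE (bigD1 i) //= mxE eqxx /= big1 ?addr0 // => l li.
by rewrite mxE (negbTE li) mulr0.
Qed.

Lemma symplectic_matrixE (u : V) k : (u *m symplectic_matrix) 0 k =
  \sum_(l < n) (u 0 (fs l) * (k == sn l)%:R - u 0 (sn l) * (k == fs l)%:R).
Proof.
rewrite /symplectic_matrix mulmx_sumr summxE; apply: eq_bigr => l _.
by rewrite mulmxBr mxE [X in _ + X]mxE !mul_row_delta.
Qed.

Lemma symplectic_formE (u v : V) : symplectic_form u v = (u *m symplectic_matrix *m v^T) 0 0.
Proof.
rewrite mxE; under eq_bigr => k _ do rewrite symplectic_matrixE mulr_suml.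
rewrite exchange_big /=; apply: eq_bigr => l _; rewrite /wedge /dz.
under eq_bigr => k _ do rewrite mxE mulrBl.
rewrite sumrB; congr (_ - _).
  rewrite (bigD1 (sn l)) //= eqxx mulr1 big1 ?addr0 // => k kl.
  by rewrite (negbTE kl) mulr0 mul0r.
rewrite (bigD1 (fs l)) //= eqxx mulr1 big1 ?addr0 1?mulrC // => k kl.
by rewrite (negbTE kl) mulr0 mul0r.
Qed.

Lemma fs_inj : injective fs.
Proof. by move=> j k /(congr1 val) /= /eqP; rewrite eqn_pmul2l // => /eqP /val_inj. Qed.

Lemma sn_inj : injective sn.
Proof. by move=> j k /(congr1 val) /= [] /eqP; rewrite eqn_pmul2l // => /eqP /val_inj. Qed.

Lemma fs_neq_sn j k : (fs j == sn k) = false.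
Proof.
by apply/negP => /eqP /(congr1 (fun x : 'I_(2 * n) => odd x)) /=; rewrite !oddM.
Qed.

Lemma symplectic_matrix_unit : symplectic_matrix \in unitmx.
Proof.
rewrite -row_free_unit; apply: inj_row_free => u u0.
have H k : (u *m symplectic_matrix) 0 k = 0 by rewrite u0 mxE.
have uf l : u 0 (fs l) = 0.
  have := H (sn l); rewrite symplectic_matrixE (bigD1 l) //= eqxx (eq_sym (sn l)) fs_neq_sn mulr1 mulr0 subr0.
  rewrite big1 ?addr0 // => k kl; rewrite (eq_sym (sn l) (fs k)) fs_neq_sn mulr0 subr0.
  by rewrite (inj_eq sn_inj) eq_sym (negbTE kl) mulr0.
have us l : u 0 (sn l) = 0.
  have := H (fs l); rewrite symplectic_matrixE (bigD1 l) //= eqxx fs_neq_sn mulr1 mulr0 sub0r.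
  rewrite big1 ?addr0 => [/eqP|k kl]; first by rewrite oppr_eq0 => /eqP.
  by rewrite fs_neq_sn mulr0 sub0r (inj_eq fs_inj) eq_sym (negbTE kl) mulr0 oppr0.
apply/rowP => i; rewrite mxE; have i2 : (i./2 < n)%N.
  by rewrite ltn_half_double -mul2n.
have := odd_double_half i; case: (boolP (odd i)) => _ E.
  by rewrite -(us (Ordinal i2)); congr (u 0 _); apply: val_inj; rewrite /= (mul2n i./2); exact: esym E.
by rewrite -(uf (Ordinal i2)); congr (u 0 _); apply: val_inj; rewrite /= (mul2n i./2); exact: esym E.
Qed.

(** Invariance of the form reads M O M^T = O with O invertible; determinants give (det M)^2 = 1. *)
Lemma symplectic_det (f : V -> V) z : holomorphic f -> symplectic f ->
  nc (\det (lin1_mx ('d f z))) = 1.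
Proof.
move=> Hf Sf; set M := lin1_mx _; set O := symplectic_matrix.
have dE u : 'd f z u = u *m M by rewrite mul_rV_lin1.
have E : M *m O *m M^T = O.
  have ent (A : 'M[C]_(2 * n)) i j : A i j = ((delta_mx 0 i : V) *m A *m (delta_mx 0 j : V)^T) 0 0.
    by rewrite trmx_delta -rowE -colE !mxE.
  apply/matrixP => i j; rewrite ent [RHS]ent -[RHS]symplectic_formE -(Sf z) /pullback symplectic_formE !dE.
  by rewrite trmx_mul !mulmxA.
have := congr1 determinant E; rewrite !det_mulmx det_tr => D.
have O0 : \det O != 0 by have := symplectic_matrix_unit; rewrite unitmxE unitfE.
have D2 : \det M * \det M = 1.
  by apply: (mulIf O0); rewrite mul1r -[RHS]D; ring.
have /eqP : nc (\det M) ^+ 2 = 1 by rewrite -ncX expr2 D2 nc1.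
by rewrite sqrf_eq1 => /orP[/eqP //|/eqP h]; have := nc_ge0 (\det M); rewrite h; lra.
Qed.

End SymplecticDeterminant.

(** * Shears, the twist and tameness *)

Section Automorphisms.
Variables (R : realType) (m : nat).
Local Notation C := R[i].
Local Notation V := 'rV[C]_m.
Local Notation nc := (@nc R).

Lemma entire_map_add (F G : V -> V) : entire_map F -> entire_map G -> entire_map (fun x => F x + G x).
Proof. by move=> HF HG i; apply: entire_eq (entireD (HF i) (HG i)) => x; rewrite mxE. Qed.

Lemma entire_map_opp (F : V -> V) : entire_map F -> entire_map (fun x => - F x).
Proof. by move=> HF i; apply: entire_eq (entireN (HF i)) => x; rewrite mxE. Qed.

Lemma entire_map_comp (F G : V -> V) : entire_map F -> entire_map G -> entire_map (G \o F).
Proof. by move=> HF HG i; exact: (entire_comp (HG i) HF). Qed.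

Lemma entire_map_row (f : 'I_m -> V -> C) : (forall i, entire (f i)) -> entire_map (fun x => \row_i f i x).
Proof. by move=> H i; apply: entire_eq (H i) => x; rewrite mxE. Qed.

Definition entire_automorphism (F : V -> V) :=
  entire_map F /\ exists G, [/\ entire_map G, cancel F G & cancel G F].

Lemma entire_automorphism_comp (F G : V -> V) :
  entire_automorphism F -> entire_automorphism G -> entire_automorphism (G \o F).
Proof.
move=> [HF [F' [HF' FK F'K]]] [HG [G' [HG' GK G'K]]]; split; first exact: entire_map_comp.
exists (F' \o G'); split; first exact: entire_map_comp.
- by move=> x /=; rewrite GK FK.
- by move=> x /=; rewrite F'K G'K.
Qed.

(** The hypotheses say that K does not change when its own value is added or subtracted, so x - K x
    is the inverse. *)
Lemma entire_shear (K : V -> V) : entire_map K ->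
  (forall x, K (x + K x) = K x) -> (forall x, K (x - K x) = K x) ->
  entire_automorphism (fun x => x + K x).
Proof.
move=> HK K1 K2; have Hid : entire_map (id : V -> V) by move=> i; exact: entire_coord.
split; first exact: entire_map_add Hid HK.
exists (fun x => x - K x); split.
- exact: entire_map_add Hid (entire_map_opp HK).
- by move=> x; rewrite K1 addrK.
- by move=> x; rewrite K2 subrK.
Qed.

(* Three shears: the first moves [p n] to [n + 1] in the coordinate [i1], the
   second uses this coordinate to move the other ones to those of
   [(n + 1) e_i0], and the third subtracts the coordinate [i0] from [i1]. *)
Lemma interpolating_automorphism (i0 i1 : 'I_m) (p : nat -> V) (s : nat -> 'I_m) : i0 != i1 ->
  injective (fun n => p n 0 i0) -> (forall n, s n != i1) ->
  (forall M, exists n0, forall n, (n0 <= n)%N -> M <= nc (p n 0 (s n))) ->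
  (forall n, p n 0 (s n) != 0) ->
  exists2 T : V -> V, entire_automorphism T & forall n, T (p n) = n.+1%:R *: delta_mx 0 i0.
Proof.
move=> i01 pinj si1 poo p0.
have [h [Hh hp hdep]] := interpolation (fun n => n.+1%:R - p n 0 i1) pinj poo p0.
pose K1 (x : V) : V := \row_i if i == i1 then h x else 0.
have K1E : entire_map K1.
  apply: entire_map_row => i; case: (i == i1) => //; exact: entire_cst.
have h1 (x : V) c : h (x + c *: K1 x) = h x.
  apply: hdep => [|n]; rewrite !mxE; first by rewrite (negbTE i01) mulr0 addr0.
  by rewrite (negbTE (si1 n)) mulr0 addr0.
have S1 : entire_automorphism (fun x => x + K1 x).
  apply: entire_shear => // x; apply/rowP => i; rewrite !mxE; case: (i == i1) => //.
    by rewrite -[K1 x]scale1r h1.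
  by rewrite -scaleN1r h1.
(* After the first shear the coordinate [i1] of the n-th point is n + 1: distinct and tending to
   infinity. It can therefore play both roles in [interpolation], and the functions obtained depend
   on it alone, so the multiples [q n] may stand in for the moved points. *)
pose q n : V := n.+1%:R *: delta_mx 0 i1.
have qi n : q n 0 i1 = n.+1%:R by rewrite !mxE !eqxx mulr1.
have qinj : injective (fun n => q n 0 i1).
  by move=> j k; rewrite !qi => /eqP; rewrite eqr_nat => /eqP [].
have qoo M : exists n0, forall n, (n0 <= n)%N -> M <= nc (q n 0 i1).
  exists (Num.bound `|M|) => n nn; rewrite qi nc_nat; apply: le_trans (ler_norm _) _.
  have := archi_boundP (normr_ge0 M); rewrite -(ler_nat R) in nn; rewrite -natr1; lra.
have q0 n : q n 0 i1 != 0 by rewrite qi pnatr_eq0.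
have [k Hk] := choice (fun i : 'I_m => interpolation (s := fun=> i1)
   (fun n => (if i == i0 then n.+1%:R else 0) - p n 0 i) qinj qoo q0).
pose K2 (x : V) : V := \row_i if i == i1 then 0 else k i x.
have K2E : entire_map K2.
  apply: entire_map_row => i; case: (i == i1); [exact: entire_cst | by case: (Hk i)].
have k1 i (x : V) c : k i (x + c *: K2 x) = k i x.
  by case: (Hk i) => _ _; apply=> [|n]; rewrite !mxE eqxx mulr0 addr0.
have S2 : entire_automorphism (fun x => x + K2 x).
  apply: entire_shear => // x; apply/rowP => i; rewrite !mxE; case: (i == i1) => //.
    by rewrite -[K2 x]scale1r k1.
  by rewrite -scaleN1r k1.
pose K3 (x : V) : V := \row_i if i == i1 then - x 0 i0 else 0.
have K3E : entire_map K3.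
  by apply: entire_map_row => i; case: (i == i1); [exact: entireN (entire_coord _) | exact: entire_cst].
have S3 : entire_automorphism (fun x => x + K3 x).
  apply: entire_shear => // x; apply/rowP => i; rewrite !mxE; case: (i == i1) => //;
  by rewrite (negbTE i01) ?oppr0 addr0.
exists ((fun x => x + K3 x) \o ((fun x => x + K2 x) \o (fun x => x + K1 x))).
  exact: entire_automorphism_comp (entire_automorphism_comp S1 S2) S3.
move=> n /=.
have E1 i : (p n + K1 (p n)) 0 i = if i == i1 then n.+1%:R else p n 0 i.
  by rewrite !mxE; case: eqP => [->|_]; rewrite ?addr0 // hp subrKC.
have E2 i : (p n + K1 (p n) + K2 (p n + K1 (p n))) 0 i = if i == i1 then n.+1%:R else if i == i0 then n.+1%:R else 0.
  rewrite mxE E1 mxE; have [_|ii] := eqVneq i i1; first by rewrite addr0.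
  have [_ kp kd] := Hk i; rewrite (kd _ (q n)) ?kp ?subrKC // => [|_]; by rewrite E1 eqxx qi.
apply/rowP => i; rewrite mxE E2 mxE E2 !mxE eqxx (negbTE i01) /=.
have [->|ii] := eqVneq i i1; first by rewrite eq_sym (negbTE i01) mulr0 subrr.
by rewrite addr0; case: (i == i0); rewrite ?mulr1 ?mulr0.
Qed.

Section Twist.
Variables (i0 i1 : 'I_m).

(* Volume preserving maps followed by [twist] have Jacobian determinant
   [exp] of their coordinate [i1], up to a factor of modulus 1. *)
Definition twist (x : V) : V := \row_i if i == i0 then x 0 i0 * cexp (x 0 i1) else x 0 i.

Lemma entire_twist : entire_map twist.
Proof.
apply: entire_map_row => i; case: (i == i0); last exact: entire_coord.
exact: entireM (entire_coord _) (entire_cexp (entire_coord _)).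
Qed.

Lemma twist_automorphism : i0 != i1 -> entire_automorphism twist.
Proof.
move=> i01; split; first exact: entire_twist.
exists (fun x => \row_i if i == i0 then x 0 i0 * cexp (- x 0 i1) else x 0 i); split.
- apply: entire_map_row => i; case: (i == i0); last exact: entire_coord.
  exact: entireM (entire_coord _) (entire_cexp (entireN (entire_coord _))).
- move=> x; apply/rowP => i; rewrite !mxE eqxx (eq_sym i1) (negbTE i01); case: eqP => // ->.
  by rewrite -mulrA cexpN divff ?mulr1 // cexp_neq0.
- move=> x; apply/rowP => i; rewrite !mxE eqxx (eq_sym i1) (negbTE i01); case: eqP => // ->.
  by rewrite -mulrA cexpN mulVf ?mulr1 // cexp_neq0.
Qed.

Lemma twist0 : twist 0 = 0.
Proof. by apply/rowP => i; rewrite !mxE mul0r; case: (i == i0). Qed.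

(** Off the diagonal only the column [i0] is nonzero. As [i0] is the first index, the matrix is
    lower triangular, and its only diagonal entry other than 1 is the exponential. *)
Lemma jacobian_twist (x : V) : val i0 = 0%N -> val i1 = 1%N ->
  exists2 J, jacobian twist x J & \det J = cexp (x 0 i1).
Proof.
move=> v0 v1; have i01 : i0 != i1 by rewrite -val_eqE /= v0 v1.
pose g : 'cV[C]_m := cexp (x 0 i1) *: delta_mx i0 0 + x 0 i0 *: (cexp (x 0 i1) *: delta_mx i1 0).
pose J : 'M[C]_m := \matrix_(i, j) if j == i0 then g i 0 else (i == j)%:R.
exists J.
  move=> j; have [->|jj] := eqVneq j i0.
    have -> : col i0 J = g by apply/colP => i; rewrite !mxE eqxx.
    have K := vdiffM (vdiff_coord i0 x) (cdiff_vdiff_comp (vdiff_coord i1 x) (cdiff_cexp (x 0 i1))).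
    by apply: vdiff_eq K => y; rewrite mxE eqxx.
  have -> : col j J = delta_mx j 0 by apply/colP => i; rewrite !mxE (negbTE jj) andbT.
  by apply: vdiff_eq (vdiff_coord j x) => y; rewrite mxE (negbTE jj).
have trig : is_trig_mx J.
  apply/is_trig_mxP => i j ij; rewrite mxE; case: eqP => [E|_]; first by rewrite E v0 in ij.
  by case: eqP => // E; rewrite E ltnn in ij.
rewrite (det_trig trig) (bigD1 i0) //= big1 => [|j jj].
  by rewrite !mxE !eqxx (negbTE i01) mulr1 !mulr0 addr0 mulr1.
by rewrite mxE (negbTE jj) eqxx.
Qed.

End Twist.

Lemma holomorphic_automorphism_entire (F : V -> V) : entire_automorphism F -> holomorphic_automorphism F.
Proof.
move=> [HF [G [HG FK GK]]]; split; first exact: entire_map_holomorphic.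
by exists G; split => //; exact: entire_map_holomorphic.
Qed.

Lemma nat_nc_close (j k : nat) : nc (j%:R - k%:R) < 1 -> j = k.
Proof.
have lt1 (a b : nat) : (a <= b)%N -> nc (b%:R - a%:R) < 1 -> a = b.
  move=> ab; rewrite -natrB // nc_nat (_ : 1 = 1%:R :> R) // ltr_nat ltnS leqn0 subn_eq0 => ba.
  by apply/eqP; rewrite eqn_leq ab.
by case: (leqP j k) => [jk|/ltnW kj]; [rewrite ncBC|move=> H; apply/esym; move: H]; exact: lt1.
Qed.

Lemma e1_delta (i0 : 'I_m) : i0 = 0%N :> nat -> e1 R m = delta_mx 0 i0.
Proof. by move=> v0; apply/rowP => i; rewrite !mxE eqxx -[i == i0]val_eqE /= v0. Qed.

(** Near a limit point there would be two distinct points of E, whose images under the continuous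
    injective T are natural multiples of e_1 at distance less than 1, hence equal. *)
Lemma automorphism_tame (T : V -> V) (E : set V) : (0 < m)%N -> entire_automorphism T ->
  T @` E = positive_multiples_e1 R m -> tame E.
Proof.
move=> m0 HT TE; split; last by exists T; split => //; exact: holomorphic_automorphism_entire.
have [HTe [G [_ TK _]]] := HT; have Tinj := can_inj TK.
rewrite -subset0 => z /= zlim.
pose i0 : 'I_m := Ordinal m0.
have [J HJ] := jacobian_exists z HTe; have [B [r [B0 r0 Hr]]] := jacobian_lip HJ.
pose d := Num.min r (4 * B)^-1.
have d0 : 0 < d by rewrite lt_min r0 invr_gt0 mulr_gt0.
have near (y : V) : vnorm (y - z) < d -> vnorm (T y - T z) < 3^-1.
  rewrite lt_min => /andP[/Hr]; rewrite subrKC => yr yB; apply: le_lt_trans yr _.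
  have : B * vnorm (y - z) <= B * (4 * B)^-1 by rewrite ler_pM2l // ltW.
  have -> : B * (4 * B)^-1 = 4^-1 by field; exact: lt0r_neq0.
  by move=> /le_lt_trans; apply; rewrite ltf_pV2 ?posrE // ltr_nat.
have pick (e : R) : 0 < e -> e <= d -> exists y, [/\ y != z, E y & vnorm (y - z) < e].
  move=> e0 ed; have [|y [y1 y2 y3]] := zlim [set y | vnorm (y - z) < e].
    by apply/nbhs_vnormP; exists e => // w we; rewrite /= addrC addKr.
  by exists y.
have [y1 [n1 E1 c1]] := pick d d0 (lexx _).
have y10 : 0 < vnorm (y1 - z).
  rewrite lt_def vnorm_ge0 andbT; apply: contra n1 => /eqP /vnorm_eq0 /eqP.
  by rewrite subr_eq0.
(* Choosing [y2] closer to z than [y1] makes the two distinct. *)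
have [y2 [n2 E2 c2]] := pick _ y10 (ltW c1).
have [j1 _ t1] : positive_multiples_e1 R m (T y1) by rewrite -TE; exists y1.
have [j2 _ t2] : positive_multiples_e1 R m (T y2) by rewrite -TE; exists y2.
suff j12 : j1 = j2.
  have y12 : y1 = y2 by apply: Tinj; rewrite t1 t2 j12.
  by move: c2; rewrite y12 ltxx.
have h1 := near y1 c1; have h2 := near y2 (lt_trans c2 c1).
have : vnorm (T y1 - T y2) < 1.
  apply: le_lt_trans (vnorm_tri _ (T z) _) _; rewrite (vnormBC (T z)); lra.
move=> /(le_lt_trans (nc_vnorm _ i0)); rewrite t1 t2 (e1_delta (i0 := i0) erefl) -scalerBl !mxE !eqxx mulr1.
exact: nat_nc_close.
Qed.

End Automorphisms.

(** * The tame set and its unavoidability *)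

Theorem mainTheorem2 (R : realType) (n : nat) (hn : (1 <= n)%N) :
  exists E : set (Cn R (2 * n)),
    [/\ tame E, E `<=` ~` [set 0] & unavoidable (Gamma R n) E].
Proof.
have m1 : (1 < 2 * n)%N by rewrite mul2n -addnn; exact: (leq_add hn hn).
have m0 : (0 < 2 * n)%N by exact: ltnW.
pose i0 : 'I_(2 * n) := Ordinal m0; pose i1 : 'I_(2 * n) := Ordinal m1.
have i01 : i0 != i1 by [].
have [a Ha] := growth_levels_exist R m0.
have ch k : exists del : R, 0 < del /\
    @covering_radius R (2 * n) (2^-1 ^+ k.+3 / 3) (a k.+1) (expR (- a k.+1)) del.
  have [|||del del0 Hdel] := @covering R (2 * n) (2^-1 ^+ k.+3 / 3) (a k.+1) (expR (- a k.+1)).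
  - by rewrite divr_gt0 // exprn_gt0 // invr_gt0.
  - exact: lt_le_trans ltr01 (growth_levels_ge1 k.+1 Ha).
  - exact: expR_gt0.
  - by exists del.
have [del Hdel] := choice ch.
have [p [s [pinj si1 poo p0 net]]] := net_sequence i01 Ha.1 (fun k => (Hdel k).1).
have [T HT Tp] := interpolating_automorphism i01 pinj si1 poo p0.
pose E : set (Cn R (2 * n)) := [set z | range p (twist i0 i1 z)].
have HTw := twist_automorphism R i01.
have TE : (T \o twist i0 i1) @` E = positive_multiples_e1 R (2 * n).
  rewrite eqEsubset; split => [_ [z [k _ pk] <-]|_ [j j0 ->]].
    by exists k.+1 => //=; rewrite -pk Tp (e1_delta R (i0 := i0) erefl).
  have [_ [G [_ _ GK]]] := HTw.
  (* The sequence starts at index 0 and the multiples of e_1 at 1, hence the predecessor. *)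
  exists (G (p j.-1)); first by exists j.-1 => //; rewrite GK.
  by rewrite /= GK Tp prednK // (e1_delta R (i0 := i0) erefl).
exists E; split.
- exact: automorphism_tame m0 (entire_automorphism_comp HTw HT) TE.
(* The twist fixes the origin, while every [p k] has a nonzero coordinate [s k]. *)
- move=> z [k _ pk] /= z0; have := p0 k.
  by rewrite pk z0 twist0 mxE eqxx.
move=> f [Hf Sf f0]; have Ef := holomorphic_entire_map Hf.
have EF : entire_map (twist i0 i1 \o f) by exact: entire_map_comp Ef (@entire_twist R _ i0 i1).
have [||z Ez] := level_net_unavoidable Ha (fun k => (Hdel k).2) net EF.
- by rewrite /= f0 twist0.
- move=> z J HJ; have Jf := differentiable_jacobian (Hf z).
  have [K HK detK] := jacobian_twist (f z) (erefl : val i0 = 0%N) (erefl : val i1 = 1%N).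
  (* By the chain rule the determinant is that of f, of modulus 1, times the exponential of the
     coordinate [i1] of f z, which the twist leaves unchanged. *)
  rewrite (jacobian_unique EF HJ (jacobian_comp Jf HK)) det_mulmx ncM symplectic_det // mul1r detK nc_cexp.
  by rewrite /= mxE.
by exists (f z); split; first exists z.
Qed.
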